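(* Let $a<b$ be real numbers and let $n$ be a positive integer. The maximal generator of the $(n+1)$-th degree bounded stochastic dominance order $\succeq_{n+1,[a,b]-BSD}$ is $cl(U_{n,[a,b]}\cap LP_{n,[a,b]})$.
   Context: $C^{m}([a,b])$ is the set of $m$ times continuously differentiable functions $u:[a,b]\to\mathbb{R}$ (one-sided derivatives at the endpoints); $u^{(k)}$ is the $k$-th derivative. ''Decreasing'' is in the weak sense. Integrals $\int_a^b\cdot\,dF$ are over the closed interval $[a,b]$, including possible atoms at $a$ and $b$. For a positive integer $n$ and $a<b$: $$U_{n,[a,b]} := \{u \in C^{n+1}([a,b]) : (-1)^{k}u^{(k)}(x) \le 0 \ \ \forall x\in[a,b],\ \forall k=1,\dots,n+1\},$$ $$LP_{n,[a,b]} := \{u:[a,b]\to\mathbb{R} : (u(b)-u(x))^{1/n} \text{ is convex and decreasing (as a function of } x) \text{ on } [a,b]\}.$$ For (probability) distribution functions $F,G$ on $[a,b]$, $G \succeq_{n+1,[a,b]-BSD} F$ means $\int_a^b \max\{c-x,0\}^n\,dF(x) \ge \int_a^b \max\{c-x,0\}^n\,dG(x)$ for all $c\in[a,b]$. The maximal generator of the order $\succeq_{n+1,[a,b]-BSD}$ is the set of all bounded (Borel measurable) functions $u:[a,b]\to\mathbb{R}$ such that, for all distribution functions $F,G$ on $[a,b]$, $G \succeq_{n+1,[a,b]-BSD} F$ implies $\int_a^b u(x)\,dG(x)\ge\int_a^b u(x)\,dF(x)$. $cl(\cdot)$ denotes the closure, in the set of functions $[a,b]\to\mathbb{R}$, with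 respect to pointwise convergence. *)

(* Defs.v *)
From HB Require Import structures.
From mathcomp Require Import all_boot all_order all_algebra.
From mathcomp Require Import all_classical all_reals all_analysis.

Set Implicit Arguments.
Unset Strict Implicit.
Unset Printing Implicit Defensive.

Import Order.TTheory GRing.Theory Num.Theory.
Import numFieldNormedType.Exports.

Local Open Scope classical_set_scope.
Local Open Scope ring_scope.

(* The compact interval as a type; its library topology is the subspace
   topology inherited from R. *)
Notation itv_cc a b := (set_type `[a, b]%classic).

Section defs.
Context {R : realType}.
Implicit Types (a b c : R) (n m k : nat).

(* Extension by 0 outside [a, b], used only to evaluate at a real number or to
   integrate; its values outside [a, b] play no role. *)
Definition ext a b (u : itv_cc a b -> R) : R -> R := 'valL_ 0 u.

Definition diff_quot a b (u : itv_cc a b -> R) (x y : itv_cc a b) : R :=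
  (u y - u x) / (\val y - \val x).

(* The filter x^' lives on [a, b], so limits at the endpoints are one-sided. *)
Definition derivable_on a b (u : itv_cc a b -> R) : Prop :=
  forall x, cvg (diff_quot u x @ x^').

Definition deriv_on a b (u : itv_cc a b -> R) : itv_cc a b -> R :=
  fun x => lim (diff_quot u x @ x^').

Definition derivn_on a b k (u : itv_cc a b -> R) : itv_cc a b -> R :=
  iter k (@deriv_on a b) u.

Definition Cm a b m : set (itv_cc a b -> R) :=
  [set u | (forall k, (k < m)%N -> derivable_on (derivn_on k u)) /\
           continuous (derivn_on m u)].

Definition U n a b : set (itv_cc a b -> R) :=
  [set u | @Cm a b n.+1 u /\
    forall k, (1 <= k <= n.+1)%N ->
    forall x, (-1) ^+ k * derivn_on k u x <= 0].

(* The first clause makes the real n-th root meaningful: powR takes junk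
   values on negative bases. *)
Definition LP n a b : set (itv_cc a b -> R) :=
  [set u | let g := fun x : R => (ext u b - ext u x) `^ (n%:R^-1) in
    [/\ forall x : itv_cc a b, u x <= ext u b,
        convex_function `[a, b]%classic (g : R^o -> R^o) &
        {in `[a, b] &, {homo g : x y / x <= y >-> y <= x}}]].

(* Probability distribution functions (nondecreasing, right-continuous, with
   limits 0 and 1) whose Lebesgue-Stieltjes measure is carried by [a, b]; an
   atom at a is the jump from 0 to F a. *)
Definition distribution_on a b (F : cumulativeBounded (0 : R) (1 : R)) : Prop :=
  (forall x : R, x < a -> F x = 0) /\ F b = 1.

Definition stieltjes a b (F : cumulativeBounded (0 : R) (1 : R)) (f : R -> R)
    : \bar R :=
  (\int[lebesgue_stieltjes_measure F]_(x in `[a, b]) (f x)%:E)%E.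

(* bsd n a b G F : G dominates F in the bounded stochastic dominance order of
   degree n + 1 on [a, b]. *)
Definition bsd n a b (G F : cumulativeBounded (0 : R) (1 : R)) : Prop :=
  forall c, c \in `[a, b] ->
    (stieltjes a b G (fun x : R => Num.max (c - x) 0 ^+ n)%R <=
     stieltjes a b F (fun x : R => Num.max (c - x) 0 ^+ n)%R)%E.

Definition maximal_generator a b
    (dom : cumulativeBounded (0 : R) (1 : R) ->
           cumulativeBounded (0 : R) (1 : R) -> Prop)
    : set (itv_cc a b -> R) :=
  [set u | [/\ bounded_fun u,
     measurable_fun `[a, b]%classic (ext u) &
     forall F G, distribution_on a b F -> distribution_on a b G ->
       dom G F ->
       (stieltjes a b F (ext u) <= stieltjes a b G (ext u))%E]].

End defs.

Arguments Cm {R} a b m.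
Arguments U {R} n a b.
Arguments LP {R} n a b.
Arguments bsd {R} n a b G F.
Arguments maximal_generator {R} a b dom.

(* Main.v *)
Require Import Defs.
From HB Require Import structures.
From mathcomp Require Import all_boot all_order all_algebra.
From mathcomp Require Import all_classical all_reals all_analysis.
From mathcomp Require Import measurable_realfun ring lra zify.

Import Order.TTheory GRing.Theory Num.Theory.
Import numFieldNormedType.Exports.

Local Open Scope classical_set_scope.
Local Open Scope ring_scope.

(* Let K be the convex cone generated by the constants and the ramps
   x |-> - max(c - x, 0)^n, c in [a, b]; both sides turn out to be the pointwise
   closure of K.
   - If u is not in cl(K), then at finitely many points it is separated from K
     by a weight vector of total mass 0 (constants lie in K). The positive and
     negative parts of the weights, normalized, are two discrete distributions
     that are ordered by BSD but on which the expectations of u have the wrong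
     order.
   - Elements of cl(K) are nondecreasing and concave, hence each is the limit
     everywhere on [a, b] of elements of K that approximate it on finer and
     finer grids, and dominated convergence gives the expectation inequality.
   - If u is in U and LP, then u(b) - u(x) = O((b - x)^n), which forces
     u^(k)(b) = 0 for 1 <= k < n, and Taylor's formula at b writes u as a
     constant plus a mixture of ramps, with discrete approximations in K.
   - A ramp is the limit of second differences of max(c - ., 0)^(n + 2), which
     are in U with vanishing derivatives at b, hence in cl(K). Finally
     cl(K) is included in LP, because the convexity of the n-th root of
     f = u(b) - u is equivalent to a family of inequalities linear in f. *)

(** * The topology of pointwise convergence and finite-dimensional separation *)

(** Basic neighbourhoods in the product topology constrain finitely many coordinates, so membership
    in a closure becomes a finite [e]-approximation statement. *)
Lemma closure_ptwsP (R : realType) (I : choiceType) (A : set {ptws I -> R})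
    (u : I -> R) :
  closure A u <-> forall (s : seq I) (e : R), 0 < e ->
    exists2 v : I -> R, A v & forall x, x \in s -> `|v x - u x| < e.
Proof.
pose V (s : seq I) (e : R) := [set v : {ptws I -> R} | forall x, x \in s -> `|v x - u x| < e].
split=> [clAu s e e0|apx].
  suff /clAu [v [Av sv]] : nbhs (u : {ptws I -> R}) (V s e) by exists v.
  elim: s => [|x s IHs]; first by apply: filterS filterT => v _ y; rewrite in_nil.
  have Nx : nbhs (u : {ptws I -> R}) [set v : {ptws I -> R} | `|v x - u x| < e].
    have nb : nbhs (u x) (ball (u x) e) by exact: nbhsx_ballx.
    have := @proj_continuous I (fun=> R) x u _ nb.
    rewrite (_ : [set v : {ptws I -> R} | `|v x - u x| < e] =
                 [set v : {ptws I -> R} | ball (u x) e (v x)]) //.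
    by apply/funext => v; rewrite /ball /= distrC.
  apply: filterS2 Nx IHs => v vx vs y; rewrite in_cons => /orP[/eqP-> //|].
  exact: vs.
(* The sets [V s e] generate a filter. Its convergence to [u] is checked one coordinate at a time,
   the pointwise topology being the supremum of the topologies pulled back along evaluations. *)
pose F := filter_from [set p : seq I * R | 0 < p.2] (fun p => V p.1 p.2).
have FF : Filter F.
  apply: filter_from_filter; first by exists ([::], 1) => /=.
  move=> [s1 e1] [s2 e2] /= e10 e20; exists (s1 ++ s2, Num.min e1 e2) => /=.
    by rewrite lt_min e10.
  move=> v vs; split=> x xs /=; have := vs x;
    by rewrite mem_cat xs ?orbT => /(_ isT); rewrite lt_min => /andP[].
have Fu : F --> (u : {ptws I -> R}).
  apply/cvg_sup => x; rewrite cvg_image => [|]; last first.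
    by apply/seteqP; split=> // y _; exists (fun=> y).
  move=> W /= /nbhs_ballP[e /= e0 eW].
  exists [set v : {ptws I -> R} | W (v x)]; last first.
    by apply/seteqP; split=> [y [v vW <-]//|y Wy]; exists (fun=> y).
  exists ([:: x], e) => //= v /(_ x); rewrite inE eqxx => /(_ isT) vx.
  by apply: eW; rewrite /ball /= distrC.
move=> W /Fu [[s e] /= e0 sW].
have [v Av vs] := apx s e e0.
by exists v; split=> //; exact: sW.
Qed.

(** Projection onto a closed convex cone, with the Euclidean inner product. Let [p] be the point of
    the closure nearest to [u] and [w = u - p]. Minimality along [p + t *: v] gives [dot w v <= 0],
    minimality along [t *: p] gives [0 <= dot w p], hence [dot w u >= dot w w > 0]. *)
Lemma nearest_point_separation (R : realType) (N : nat) (C : set 'rV[R]_N)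
    (u : 'rV[R]_N) : C 0 ->
    (forall v w, C v -> C w -> C (v + w)) ->
    (forall (t : R) v, 0 <= t -> C v -> C (t *: v)) ->
    ~ closure C u ->
  exists2 w : 'rV[R]_N, (forall v, C v -> \sum_i w 0 i * v 0 i <= 0) &
    0 < \sum_i w 0 i * u 0 i.
Proof.
move=> C0 CD CZ nCu.
pose dot (x y : 'rV[R]_N) := \sum_i x 0 i * y 0 i.
pose d (x : 'rV[R]_N) := dot (x - u) (x - u).
have dotDr x y z : dot x (y + z) = dot x y + dot x z.
  by rewrite /dot -big_split; apply: eq_bigr => i _; rewrite mxE mulrDr.
have dotZr t x y : dot x (t *: y) = t * dot x y.
  by rewrite /dot mulr_sumr; apply: eq_bigr => i _; rewrite mxE mulrCA.
have dotC x y : dot x y = dot y x by apply: eq_bigr => i _; rewrite mulrC.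
have dot_ge0 x : 0 <= dot x x.
  by apply: sumr_ge0 => i _; rewrite -expr2 sqr_ge0.
have dE p q t : d (p + t *: q) = d p + 2 * t * dot (p - u) q + t ^+ 2 * dot q q.
  rewrite /d (_ : p + t *: q - u = (p - u) + t *: q); last by rewrite addrAC.
  move: (p - u) => x; rewrite dotDr dotZr (dotC _ x) (dotC _ q) !dotDr !dotZr.
  by rewrite (dotC q x); ring.
pose A := closure C `&` [set q | d q <= d 0].
have dcont : continuous d.
  pose g i (y : 'rV[R]_N) := (y - u) 0 i.
  have cg i : continuous (g i).
    rewrite (_ : g i = (fun y => y 0 i) - cst (u 0 i)); last first.
      by apply/funext => y; rewrite /g !mxE.
    move=> x; apply: (@continuousB R R 'rV[R]_N); last exact: cst_continuous.
    exact: (@coord_continuous R 1 N 0 i x).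
  suff H (r : seq 'I_N) : continuous (fun x => \sum_(i <- r) g i x * g i x).
    exact: H.
  elim: r => [|i r IHr] x.
    under eq_fun do rewrite big_nil.
    exact: (@cst_continuous 'rV[R]_N R 0 x).
  under eq_fun do rewrite big_cons.
  apply: (@continuousD R R 'rV[R]_N); last exact: IHr.
  by apply: (@continuousM R 'rV[R]_N); exact: cg.
have Acl : closed A.
  apply: closedI; first exact: closed_closure.
  by apply: (@closed_comp _ _ d [set y | y <= d 0]) => [x _|]; [exact: dcont|exact: closed_le].
have A0 : A !=set0 by exists 0; split; [exact: subset_closure|exact: lexx].
have Abd : bounded_set A.
  (* The norm of row vectors is the maximum norm, and a coordinate [z] of [q - u] satisfies
     [z ^+ 2 <= d 0], hence is at most [d 0 + 1] in absolute value. *)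
  exists (`|u| + d 0 + 1); split; first by rewrite num_real.
  move=> M ltM q [_ /= dq].
  apply: le_trans (ltW ltM); rewrite -[q](subrK u).
  apply: le_trans (ler_normD _ _) _; rewrite -addrA [leRHS]addrC lerD2r.
  rewrite [leLHS]/Num.norm /= mx_normrE; apply/bigmax_leP; split => [|[i j] _ /=].
    by rewrite addr_ge0 // dot_ge0.
  have : (q - u) 0 j ^+ 2 <= d 0.
    apply: le_trans dq; rewrite /d /dot (bigD1 j) //= -expr2 lerDl.
    by apply: sumr_ge0 => k _; rewrite -expr2 sqr_ge0.
  rewrite (ord1 i); move: (dot_ge0 (0 - u)); rewrite -/(d 0) => ? ?.
  by rewrite ler_norml; apply/andP; split; nra.
have [p Ap pmin] : exists2 p, A p & forall q, A q -> d p <= d q.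
  have [||p] := @EVT_min_rV R N d A A0.
  - exact: bounded_closed_compact.
  - exact: continuous_subspaceT.
  by rewrite inE => Ap pm; exists p => // q Aq; apply: pm; rewrite inE.
have {}pmin q : closure C q -> d p <= d q.
  move=> Cq; have [q0|/ltW q0] := leP (d q) (d 0); first exact: pmin.
  by apply: le_trans q0; case: Ap.
have {A0 Abd Acl}Cp : closure C p by case: Ap.
have clD v t : C v -> 0 <= t -> closure C (p + t *: v).
  move=> Cv t0 W /nbhs_ballP[e /= e0 eW].
  have [q [Cq pq]] := Cp _ (nbhsx_ballx p e e0).
  exists (q + t *: v); split; first by apply: CD => //; exact: CZ.
  apply: eW; move: pq; rewrite /ball /= /mx_ball => -[_ pq]; split=> // i j.
  have := pq i j; rewrite /ball /= !mxE.
  by rewrite opprD addrACA subrr addr0.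
have clZ t : 0 <= t -> t <= 1 -> closure C (t *: p).
  move=> t0 t1 W /nbhs_ballP[e /= e0 eW].
  have [q [Cq pq]] := Cp _ (nbhsx_ballx p e e0).
  exists (t *: q); split; first exact: CZ.
  apply: eW; move: pq; rewrite /ball /= /mx_ball => -[_ pq]; split=> // i j.
  have := pq i j; rewrite /ball /= !mxE -mulrBr normrM (ger0_norm t0).
  by apply: le_lt_trans; rewrite ler_piMl.
(* First-order condition at [t = 0]: if [x < 0], the quadratic is negative at
   [t = min 1 (- x / (y + 1))]. *)
have quad (x y : R) : 0 <= y ->
    (forall t, 0 < t -> t <= 1 -> 0 <= 2 * t * x + t ^+ 2 * y) -> 0 <= x.
  move=> y0 h; rewrite leNgt; apply/negP => x0.
  pose t := Num.min 1 (- x / (y + 1)).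
  have t0 : 0 < t by rewrite lt_min ltr01 /= divr_gt0 //; lra.
  have t1 : t <= 1 by rewrite ge_min lexx.
  have ty : t * (y + 1) <= - x.
    by rewrite -ler_pdivlMr ?ge_min ?lexx ?orbT //; lra.
  have := h t t0 t1; nra.
have dotNl v : dot (u - p) v = - dot (p - u) v.
  by rewrite -mulN1r [in RHS]dotC -dotZr scaleN1r opprB dotC.
have wC v : C v -> dot (u - p) v <= 0.
  move=> Cv; rewrite dotNl oppr_le0.
  apply: (quad _ (dot v v)) => // t t0 t1.
  by have := pmin _ (clD v t Cv (ltW t0)); rewrite dE; lra.
have wp : 0 <= dot (u - p) p.
  apply: (quad _ (dot p p)) => // t t0 t1.
  have := pmin _ (clZ (1 - t) _ _); rewrite subr_ge0 gerBl (ltW t0) => /(_ t1 isT).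
  rewrite (_ : (1 - t) *: p = p + (- t) *: p); last first.
    by rewrite scalerBl scale1r scaleNr.
  by rewrite dE dotNl; lra.
exists (u - p); first exact: wC.
rewrite -[X in 0 < X]/(dot _ u) -[X in dot _ X](subrK p) dotDr ltr_wpDr //.
rewrite lt_neqAle dot_ge0 andbT eq_sym; apply/eqP => d0.
apply: nCu; suff -> : u = p by [].
apply/eqP; rewrite -subr_eq0; apply/eqP/rowP => i; rewrite [RHS]mxE.
have : (u - p) 0 i * (u - p) 0 i = 0.
  by apply: (psumr_eq0P _ d0) => // j _; rewrite -expr2 sqr_ge0.
by move/eqP; rewrite mulf_eq0 orbb => /eqP.
Qed.

(** A linear inequality between finitely many values is a closed condition. Properties of the cone
    pass to its closure in this way. *)
Lemma closure_ptws_ge0 (R : realType) (I : choiceType) (A : set {ptws I -> R})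
    (u : I -> R) (s : seq (R * I)) :
  (forall v : I -> R, A v -> 0 <= \sum_(p <- s) p.1 * v p.2) -> closure A u ->
  0 <= \sum_(p <- s) p.1 * u p.2.
Proof.
move=> As /closure_ptwsP Au; rewrite leNgt; apply/negP => u0.
pose M := \sum_(p <- s) `|p.1|.
have M0 : 0 <= M by apply: sumr_ge0.
(* An [e]-close [v] changes the sum by at most [M * e], which is less than the deficit; the [+ 1]
   covers [M = 0]. *)
pose e := - (\sum_(p <- s) p.1 * u p.2) / (M + 1).
have e0 : 0 < e by rewrite divr_gt0 // ?oppr_gt0 // ltr_wpDl.
have [v /As v0 vu] := Au (map snd s) e e0.
have : \sum_(p <- s) p.1 * v p.2 <= \sum_(p <- s) p.1 * u p.2 + M * e.
  rewrite -lerBlDl -sumrB mulr_suml big_seq [leRHS]big_seq.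
  apply: ler_sum => p ps; rewrite -mulrBr (le_trans (ler_norm _)) // normrM.
  by rewrite ler_wpM2l // ltW // vu //; apply: map_f.
have -> : M * e = - (\sum_(p <- s) p.1 * u p.2) - e.
  rewrite /e; field; lra.
lra.
Qed.

(** * Distributions on an interval *)

Lemma cdf_stieltjes {R : realType} (F : cumulativeBounded (0 : R) (1 : R)) r :
  lebesgue_stieltjes_measure F `]-oo, r] = (F r)%:E.
Proof.
rewrite -(cdf_lebesgue_stieltjes_id F r) /cdf /distribution /pushforward.
by rewrite preimage_id.
Qed.

Lemma probability_cdf_exists {R : realType}
    (P : probability (measurableTypeR R) R) :
  exists F : cumulativeBounded (0 : R) (1 : R), forall A, measurable A ->
    lebesgue_stieltjes_measure F A = P A.
Proof.
have := @lebesgue_stieltjes_cdf_id R P.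
set G := (X in lebesgue_stieltjes_measure X) => GP.
have GNy : G @ -oo --> (0 : R) by exact/fine_cvg/cvg_cdfNy0.
have Gy : G @ +oo --> (1 : R) by exact/fine_cvg/cvg_cdfy1.
pose F : cumulativeBounded (0 : R) (1 : R) :=
  HB.pack (G : R -> R) (Cumulative.on (G : R -> R))
   (isCumulativeBounded.Build R 0 1 (G : R -> R) GNy Gy).
by exists F.
Qed.

Definition discrete_measure {R : realType} (x : nat -> R) (w : nat -> {nonneg R})
    N : {measure set (measurableTypeR R) -> \bar R} :=
  msum (fun k => mscale (w k) (@dirac _ (measurableTypeR R) (x k) R)) N.

Lemma integral_discrete {R : realType} (D : set (measurableTypeR R))
    (x : nat -> R) (w : nat -> {nonneg R}) N (f : R -> R) :
  measurable D -> (forall k, D (x k)) -> measurable_fun D f ->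
  (\int[discrete_measure x w N]_(y in D) (f y)%:E =
    (\sum_(k < N) (w k)%:num * f (x k))%:E)%E.
Proof.
move=> mD Dx mf.
have mEf : measurable_fun D (EFin \o f : measurableTypeR R -> \bar R).
  exact/measurable_EFinP.
have ge0 (g : measurableTypeR R -> \bar R) : measurable_fun D g ->
    (forall y, 0 <= g y)%E ->
    (\int[discrete_measure x w N]_(y in D) g y =
    \sum_(k < N) (w k)%:num%:E * g (x k))%E.
  move=> mg g0; rewrite /discrete_measure ge0_integral_measure_sum //; apply: eq_bigr => k _.
  rewrite ge0_integral_mscale // integral_dirac // diracE mem_set ?mul1e //.
(* The nonnegative case is additivity in the measure; a signed [f] is split into its positive and
   negative parts. *)
rewrite integralE ge0 //; last exact: measurable_funepos.
rewrite ge0 //; last exact: measurable_funeneg.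
rewrite funerpos funerneg /=.
under eq_bigr do rewrite -EFinM.
under [X in (_ - X)%E]eq_bigr do rewrite -EFinM.
rewrite !sumEFin -EFinB -sumrB; congr (_%:E); apply: eq_bigr => k _.
by rewrite -mulrBr; congr (_ * _); rewrite -[in RHS](funrposBneg f).
Qed.

Lemma discrete_distribution {R : realType} (a b : R) (x w : nat -> R) N :
  (forall k, x k \in `[a, b]) -> (forall k, 0 <= w k) ->
  \sum_(k < N) w k = 1 ->
  exists2 F : cumulativeBounded (0 : R) (1 : R), distribution_on a b F &
    forall f : R -> R, measurable_fun `[a, b]%classic f ->
    stieltjes a b F f = (\sum_(k < N) w k * f (x k))%:E.
Proof.
move=> xab w0 w1; pose wn k := NngNum (w0 k).
pose m := discrete_measure x wn N.
have mE A : m A = (\sum_(k < N) (w k)%:E * \d_(x k) A)%E by [].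
have m1 : m setT = 1%E.
  by rewrite mE -[RHS]/(1%:E) -w1 -sumEFin; apply: eq_bigr => k _; rewrite diracT mule1.
pose P : probability (measurableTypeR R) R :=
  HB.pack (Measure.sort m) (Measure_isProbability.Build _ _ _ m m1).
have [F FP] := probability_cdf_exists P.
exists F.
  split=> [y ya|]; apply: EFin_inj; rewrite -cdf_stieltjes FP // [LHS]mE.
    rewrite big1 // => k _; rewrite diracE memNset ?mule0 //= in_itv /=.
    by move: (xab k); rewrite in_itv /= => /andP[ax _]; apply/negP; rewrite -ltNge (lt_le_trans ya).
  rewrite -[RHS]/(1%:E) -w1 -sumEFin; apply: eq_bigr => k _.
  by rewrite diracE mem_set ?mule1 //= in_itv /=; move: (xab k); rewrite in_itv /= => /andP[].
move=> f mf; rewrite /stieltjes.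
rewrite (eq_measure_integral m) => [|A mA _]; last exact: FP.
exact: integral_discrete.
Qed.

(** [F b = 1] is the mass of the half-line up to [b]. Since [F] vanishes only strictly to the left
    of [a], the open half-line below [a] is exhausted by the null half-lines ending at
    [a - k.+1%:R^-1], and an atom at [a] stays inside. *)
Lemma distribution_mass {R : realType} (a b : R) (F : cumulativeBounded (0 : R) (1 : R)) :
  a <= b -> distribution_on a b F -> lebesgue_stieltjes_measure F `[a, b] = 1%E.
Proof.
move=> ab [Fa Fb].
have Fa0 : lebesgue_stieltjes_measure F `]-oo, a[ = 0%E.
  apply: measure_negligible; first exact: measurable_itv.
  rewrite (_ : `]-oo, a[%classic =
      \bigcup_k `]-oo, a - k.+1%:R^-1]%classic); last first.
    apply/seteqP; split=> [y /=|y [k _] /=]; rewrite !in_itv /= => ya.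
      have /ltr_add_invr[k yk] := ya.
      by exists k => //=; rewrite in_itv /= lerBrDr ltW.
    by apply: le_lt_trans ya _; rewrite gtrBl invr_gt0.
  apply: negligible_bigcup => k; apply/negligibleP; first exact: measurable_itv.
  transitivity (F (a - k.+1%:R^-1))%:E; first exact: cdf_stieltjes.
  by rewrite Fa // gtrBl invr_gt0.
have : lebesgue_stieltjes_measure F `]-oo, b] = 1%E by rewrite cdf_stieltjes Fb.
rewrite (_ : `]-oo, b]%classic = `]-oo, a[ `|` `[a, b]); last first.
  apply/seteqP; split=> [y|y []] /=; rewrite !in_itv /=.
  - by case: (ltP y a) => ya yb; [left|right].
  - by move=> /ltW ya; exact: le_trans ya ab.
  - by case/andP.
rewrite measureU; [|exact: measurable_itv|exact: measurable_itv|].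
  move=> <-; rewrite -[LHS]add0e; congr (_ + _)%E; exact: esym Fa0.
apply/seteqP; split=> [y /=|//]; rewrite !in_itv /= => -[ya /andP[ay _]].
by move: ya; rewrite ltNge ay.
Qed.

(** * The cone generated by constants and ramps *)

(** In the induction step the defect is [s * (1 - s) * ((A - B) * (A ^+ n - B ^+ n))], where both
    differences have the same sign. *)
Lemma exprn_convex {R : realType} (s A B : R) n : 0 <= s -> s <= 1 ->
  0 <= A -> 0 <= B ->
  (s * A + (1 - s) * B) ^+ n <= s * A ^+ n + (1 - s) * B ^+ n.
Proof.
move=> s0 s1 A0 B0; elim: n => [|n IHn]; first by rewrite !expr0; lra.
have s1' : 0 <= 1 - s by lra.
have := ler_wpM2l (addr_ge0 (mulr_ge0 s0 A0) (mulr_ge0 s1' B0)) IHn.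
rewrite -exprS => /le_trans; apply.
suff : 0 <= s * (1 - s) * ((A - B) * (A ^+ n - B ^+ n)) by rewrite !exprS; lra.
apply: mulr_ge0; first exact: mulr_ge0.
have [AB|/ltW BA] := leP A B.
  by apply: mulr_le0; rewrite subr_le0 // lerXn2r.
by apply: mulr_ge0; rewrite subr_ge0 // lerXn2r.
Qed.

(* Equality holds for X = al and Y = be. The right-hand side is linear in the
   powers of X and Y, which is what makes convexity of an n-th root stable under
   sums and pointwise limits. *)
Lemma exprn_convex_weighted {R : realType} (t al be X Y : R) m :
  0 <= t -> t <= 1 -> 0 < al -> 0 < be -> 0 <= X -> 0 <= Y ->
  (t * X + (1 - t) * Y) ^+ m.+1 <= (t * al + (1 - t) * be) ^+ m *
    (t / al ^+ m * X ^+ m.+1 + (1 - t) / be ^+ m * Y ^+ m.+1).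
Proof.
move=> t0 t1 al0 be0 X0 Y0; set S := t * al + (1 - t) * be.
have S0 : 0 < S by rewrite /S; nra.
have tal : 0 <= t * al by rewrite mulr_ge0 // ltW.
have tbe : 0 <= (1 - t) * be by rewrite mulr_ge0 ?subr_ge0 // ltW.
have s0 : 0 <= t * al / S by rewrite divr_ge0 // ltW.
have s1 : t * al / S <= 1 by rewrite ler_pdivrMr // mul1r /S lerDl.
(* Convexity of the power at the points [X / al] and [Y / be] with weight [t * al / S], whose mean
   is [(t * X + (1 - t) * Y) / S]. *)
have := exprn_convex (t * al / S) (X / al) (Y / be) m.+1 s0 s1
  (divr_ge0 X0 (ltW al0)) (divr_ge0 Y0 (ltW be0)).
have -> : 1 - t * al / S = (1 - t) * be / S.
  by rewrite /S; field; rewrite -/S gt_eqF.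
have -> : t * al / S * (X / al) + (1 - t) * be / S * (Y / be) =
    (t * X + (1 - t) * Y) / S.
  by field; rewrite !gt_eqF.
rewrite exprMn exprVn ler_pdivrMr ?exprn_gt0 // => /le_trans; apply.
rewrite !exprMn !exprVn !exprS le_eqVlt; apply/orP; left; apply/eqP.
by field; rewrite !gt_eqF ?exprn_gt0.
Qed.

Definition itv_pt {R : realType} (a b x : R) (ax : a <= x) (xb : x <= b) :
    itv_cc a b :=
  exist _ x (mem_set (introT andP (conj ax xb) : `[a, b]%classic x)).

Lemma itv_ptP {R : realType} (a b : R) (x : itv_cc a b) :
  a <= \val x /\ \val x <= b.
Proof. by case: x => x /= /set_mem /andP. Qed.

Lemma extE {R : realType} (a b : R) (u : itv_cc a b -> R) (x : itv_cc a b) :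
  ext u (\val x) = u x.
Proof. by have /(congr1 (@^~ x)) := @valLK _ _ 0 `[a, b]%classic u. Qed.

(** The inductive form makes every linear inequality on the cone a check on constants, on ramps and
    on sums. Scaling is put into the ramps only; it is recovered for the whole cone in
    [ramp_cone_scale]. *)
Inductive ramp_cone {R : realType} (a b : R) (n : nat) :
    (itv_cc a b -> R) -> Prop :=
| ramp_cone_cst k : ramp_cone a b n (fun=> k)
| ramp_cone_ramp c r : c \in `[a, b] -> 0 <= r ->
    ramp_cone a b n (fun x => - (r * Num.max (c - \val x) 0 ^+ n))
| ramp_cone_add f g : ramp_cone a b n f -> ramp_cone a b n g ->
    ramp_cone a b n (fun x => f x + g x).

Local Notation clcone a b n :=
  (closure (ramp_cone a b n : set {ptws itv_cc a b -> _})).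

Lemma ramp_cone_scale {R : realType} (a b : R) n (t : R) f : 0 <= t ->
  ramp_cone a b n f -> ramp_cone a b n (fun x => t * f x).
Proof.
move=> t0; elim=> [k|c r cab r0|{}f g _ IHf _ IHg].
- exact: ramp_cone_cst.
- under eq_fun do rewrite mulrN mulrA.
  by apply: ramp_cone_ramp => //; exact: mulr_ge0.
- under eq_fun do rewrite mulrDr.
  exact: ramp_cone_add.
Qed.

Lemma ramp_cone_sum {R : realType} (a b : R) n N (f : nat -> itv_cc a b -> R) :
  (forall i, (i < N)%N -> ramp_cone a b n (f i)) ->
  ramp_cone a b n (fun x => \sum_(i < N) f i x).
Proof.
elim: N => [|N IHN] Hf.
  under eq_fun do rewrite big_ord0.
  exact: ramp_cone_cst.
under eq_fun do rewrite big_ord_recr /=.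
apply: ramp_cone_add; last exact: Hf.
by apply: IHN => i iN; apply: Hf; exact: ltnW.
Qed.

(** * Monotonicity and root convexity in the closed cone *)

Lemma clcone_mono {R : realType} (a b : R) n u : clcone a b n u ->
  forall x y : itv_cc a b, \val x <= \val y -> u x <= u y.
Proof.
move=> cu x y xy.
have := closure_ptws_ge0 R _ _ u [:: (1, y); (-1, x)] _ cu.
rewrite !big_cons !big_nil /= addr0 mul1r mulN1r subr_ge0; apply => v.
rewrite !big_cons !big_nil /= addr0 mul1r mulN1r subr_ge0.
elim=> [//|c r cab r0|f g _ fxy _ gxy]; last exact: lerD.
have mx0 w : (Num.max w 0 : R) \is Num.nneg by rewrite nnegrE le_max lexx orbT.
rewrite lerN2 ler_wpM2l // lerXn2r //.
by rewrite ge_max !le_max lexx orbT andbT lerD2l lerN2 xy.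
Qed.

(** The inequality is linear in the values of [u] at four points, so it is enough to have it on
    ramps. A ramp vanishes at [b], and its base [max (c - x) 0] is convex in [x], so
    [exprn_convex_weighted] applies. *)
Lemma clcone_root_convex {R : realType} (a b : R) m u : clcone a b m.+1 u ->
  forall (x y z p : itv_cc a b) (t al be : R), \val p = b -> 0 <= t -> t <= 1 ->
  \val z = t * \val x + (1 - t) * \val y -> 0 < al -> 0 < be ->
  u p - u z <= (t * al + (1 - t) * be) ^+ m *
    (t / al ^+ m * (u p - u x) + (1 - t) / be ^+ m * (u p - u y)).
Proof.
move=> cu x y z p t al be pb t0 t1 zE al0 be0.
pose S := (t * al + (1 - t) * be) ^+ m.
pose c1 := S * (t / al ^+ m); pose c2 := S * ((1 - t) / be ^+ m).
suff : 0 <= c1 * (u p - u x) + c2 * (u p - u y) - (u p - u z).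
  by rewrite /c1 /c2 -/S; lra.
(* The four coefficients add up to 0, so constants cancel. *)
have := closure_ptws_ge0 R _ _ u [:: (c1 + c2 - 1, p); (1, z); (- c1, x); (- c2, y)] _ cu.
rewrite !big_cons !big_nil /= => H; apply: le_trans (H _) _; last by lra.
move=> v; rewrite !big_cons !big_nil /=; elim=> [k|c r cab r0|f g _ Hf _ Hg].
- lra.
- rewrite pb; have cb : c - b <= 0 by move: cab; rewrite in_itv /= subr_le0 => /andP[].
  rewrite (max_idPr cb) expr0n /=.
  suff : Num.max (c - \val z) 0 ^+ m.+1 <=
      c1 * Num.max (c - \val x) 0 ^+ m.+1 + c2 * Num.max (c - \val y) 0 ^+ m.+1.
    move=> /(ler_wpM2l r0); lra.
  have mx0 w : 0 <= Num.max w 0 :> R by rewrite le_max lexx orbT.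
  have W := exprn_convex_weighted t al be _ _ m t0 t1 al0 be0
    (mx0 (c - \val x)) (mx0 (c - \val y)).
  apply: (@le_trans _ _ ((t * Num.max (c - \val x) 0 +
    (1 - t) * Num.max (c - \val y) 0) ^+ m.+1)); last first.
    by move: W; rewrite -/S /c1 /c2; lra.
  have t1' : 0 <= 1 - t by lra.
  rewrite lerXn2r ?nnegrE ?addr_ge0 ?mulr_ge0 // ge_max addr_ge0 ?mulr_ge0 // andbT.
  have -> : c - \val z = t * (c - \val x) + (1 - t) * (c - \val y) by rewrite zE; ring.
  by apply: lerD; apply: ler_wpM2l => //; rewrite le_max lexx.
- lra.
Qed.

Lemma powR_invnK {R : realType} (y : R) m : 0 <= y -> (y `^ m.+1%:R^-1) ^+ m.+1 = y.
Proof.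
by move=> y0; rewrite -powR_mulrn ?powR_ge0 // -powRrM mulVf ?powRr1 ?pnatr_eq0.
Qed.

Lemma powR_invn_le {R : realType} (x y : R) m : 0 <= x -> 0 <= y -> x <= y ^+ m.+1 ->
  x `^ m.+1%:R^-1 <= y.
Proof.
move=> x0 y0 xy; rewrite -(@ler_pXn2r _ m.+1) ?nnegrE ?powR_ge0 //.
by rewrite powR_invnK.
Qed.

Lemma clcone_LP {R : realType} (a b : R) m u : a < b ->
  clcone a b m.+1 u -> LP m.+1 a b u.
Proof.
move=> ab cu; pose pb : itv_cc a b := itv_pt a b b (ltW ab) (lexx b).
have ub : ext u b = u pb by rewrite -(extE a b u pb).
have le_ub x : u x <= u pb.
  by apply: (clcone_mono _ _ _ _ cu); have [] := itv_ptP a b x.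
have le_root (x y : itv_cc a b) : \val x <= \val y ->
    (u pb - u y) `^ m.+1%:R^-1 <= (u pb - u x) `^ m.+1%:R^-1.
  move=> xy; apply: ge0_ler_powR; rewrite ?nnegrE ?subr_ge0 ?invr_ge0 //.
  by rewrite lerD2l lerN2; exact: (clcone_mono _ _ _ _ cu).
have core (s x y : R) : 0 <= s -> s <= 1 -> a <= x -> x <= b -> a <= y -> y <= b ->
    (u pb - ext u (s * x + (1 - s) * y)) `^ m.+1%:R^-1 <=
    s * (u pb - ext u x) `^ m.+1%:R^-1 + (1 - s) * (u pb - ext u y) `^ m.+1%:R^-1.
  move=> s0 s1 ax xb ay yb.
  have nneg p q : p <= q -> 0 <= s * (q - p) /\ 0 <= (1 - s) * (q - p).
    by move=> pq; rewrite !mulr_ge0 // subr_ge0.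
  have az : a <= s * x + (1 - s) * y.
    by have [] := nneg a x ax; have [] := nneg a y ay; lra.
  have zb : s * x + (1 - s) * y <= b.
    by have [] := nneg x b xb; have [] := nneg y b yb; lra.
  pose px := itv_pt a b x ax xb; pose py := itv_pt a b y ay yb.
  pose pz := itv_pt a b _ az zb.
  rewrite (extE a b u px : ext u x = _) (extE a b u py : ext u y = _).
  rewrite (extE a b u pz : ext u (s * x + (1 - s) * y) = _).
  set gx := (u pb - u px) `^ _; set gy := (u pb - u py) `^ _.
  have gx0 : 0 <= gx by exact: powR_ge0.
  have gy0 : 0 <= gy by exact: powR_ge0.
  have gxE : gx ^+ m.+1 = u pb - u px by rewrite powR_invnK ?subr_ge0.
  have gyE : gy ^+ m.+1 = u pb - u py by rewrite powR_invnK ?subr_ge0.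
  (* The optimal parameters [al] and [be] are the roots [gx] and [gy] themselves; adding [e] keeps
     them positive when a root is 0. *)
  apply/ler_addgt0Pr => e e0.
  have xe0 : 0 < gx + e by lra.
  have ye0 : 0 < gy + e by lra.
  have -> : s * gx + (1 - s) * gy + e = s * (gx + e) + (1 - s) * (gy + e) by ring.
  have S0 : 0 <= s * (gx + e) + (1 - s) * (gy + e) by nra.
  apply: powR_invn_le; rewrite ?subr_ge0 //.
  have := clcone_root_convex _ _ _ _ cu px py pz pb s _ _ erefl s0 s1 erefl xe0 ye0.
  move=> /le_trans; apply; rewrite [leRHS]exprSr ler_wpM2l ?exprn_ge0 //.
  rewrite -gxE -gyE; apply: lerD.
    rewrite -mulrA ler_wpM2l // mulrC ler_pdivrMr ?exprn_gt0 // -exprS.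
    by apply: lerXn2r; rewrite ?nnegrE ?lerDl // ltW.
  rewrite -mulrA ler_wpM2l ?subr_ge0 // mulrC ler_pdivrMr ?exprn_gt0 // -exprS.
  by apply: lerXn2r; rewrite ?nnegrE ?lerDl // ltW.
split.
- by move=> x; rewrite ub.
- move=> t x y /set_mem /= /andP[ax xb] /set_mem /= /andP[ay yb]; rewrite ub.
  exact: (core t%:num x y (ge0 t) (le1 t)).
- move=> x y; rewrite !in_itv /= => /andP[ax xb] /andP[ay yb] xy; rewrite ub.
  have := le_root (itv_pt a b x ax xb) (itv_pt a b y ay yb) xy.
  by rewrite -(extE a b u (itv_pt a b x ax xb)) -(extE a b u (itv_pt a b y ay yb)).
Qed.

(** * Derivatives on a closed interval *)

Lemma nbhs_itvP {R : realType} (a b : R) (x : itv_cc a b) (A : set (itv_cc a b)) :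
  nbhs x A <-> exists2 d : R, 0 < d &
    forall y, `|\val y - \val x| < d -> A y.
Proof.
split=> [/nbhs_ballP[d /= d0 dA]|[d d0 dA]].
  exists d => // y xy; apply: dA.
  by rewrite -initial_ballE /= /ball /= distrC.
apply/nbhs_ballP; exists d => //= y.
by rewrite -initial_ballE /= /ball /= distrC => /dA.
Qed.

Lemma diff_quot_cvgP {R : realType} (a b : R) (u : itv_cc a b -> R) x (l : R) :
  diff_quot u x @ x^' --> l <-> forall e, 0 < e -> exists2 d : R, 0 < d &
    forall y, y != x -> `|\val y - \val x| < d -> `|diff_quot u x y - l| < e.
Proof.
have FF : Filter x^' by exact: dnbhs_filter.
split=> [/cvgrPdist_lt ul e e0|H].
  have /nbhs_itvP[d d0 dP] := ul e e0.
  by exists d => // y yx xy; rewrite distrC; exact: dP.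
apply/cvgrPdist_lt => e e0; have [d d0 dP] := H e e0.
by apply/nbhs_itvP; exists d => // y xy yx; rewrite distrC; exact: dP.
Qed.

(** As [a < b], no point is isolated: [x] is approached from the right if [x < b] and from the left
    otherwise. Properness makes limits unique, so that [deriv_on] can be computed. *)
Lemma dnbhs_itv_proper {R : realType} (a b : R) (ab : a < b) (x : itv_cc a b) :
  ProperFilter x^'.
Proof.
split; last exact: dnbhs_filter.
move=> /nbhs_itvP[d d0 dP].
have [ax xb] := itv_ptP a b x.
have [xb'|bx] := ltP (\val x) b.
  have [y [xy yb yd]] : exists y, [/\ \val x < y, y <= b & y <= \val x + d / 2].
    exists (Num.min b (\val x + d / 2)).
    by split; rewrite ?ge_min ?lexx ?orbT // lt_min xb' ltrDl divr_gt0.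
  apply: (dP (itv_pt a b y (le_trans ax (ltW xy)) yb)).
    change (`|y - \val x| < d); by rewrite gtr0_norm ?subr_gt0 //; lra.
  by apply/eqP => /(congr1 val) /= yx; rewrite yx ltxx in xy.
have [y [xy ay yd]] : exists y, [/\ y < \val x, a <= y & \val x - d / 2 <= y].
  exists (Num.max a (\val x - d / 2)).
  split; rewrite ?le_max ?lexx ?orbT //.
  by rewrite gt_max (lt_le_trans ab bx) gtrDl oppr_lt0 divr_gt0.
apply: (dP (itv_pt a b y ay (le_trans (ltW xy) xb))).
  change (`|y - \val x| < d); by rewrite ltr0_norm ?subr_lt0 //; lra.
by apply/eqP => /(congr1 val) /= yx; rewrite yx ltxx in xy.
Qed.

(** A relational derivative: the derivatives can be supplied explicitly, and [lim] appears only when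
    returning to [deriv_on]. *)
Definition has_deriv {R : realType} (a b : R) (u u' : itv_cc a b -> R) :=
  forall x, diff_quot u x @ x^' --> u' x.

Lemma derivable_on_has_deriv {R : realType} (a b : R) (u : itv_cc a b -> R) :
  derivable_on u -> has_deriv a b u (deriv_on u).
Proof. by move=> du x; exact: du. Qed.

Lemma has_deriv_deriv_on {R : realType} (a b : R) (ab : a < b)
    (u u' : itv_cc a b -> R) :
  has_deriv a b u u' -> derivable_on u /\ deriv_on u = u'.
Proof.
move=> H; split=> [x|]; first by apply/cvg_ex; exists (u' x); exact: H.
apply/funext => x; have PF := dnbhs_itv_proper a b ab x.
by apply: cvg_lim; [exact: norm_hausdorff|exact: H].
Qed.

Lemma has_deriv_continuous {R : realType} (a b : R) (u u' : itv_cc a b -> R) :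
  has_deriv a b u u' -> {within `[a, b], continuous (ext u)}.
Proof.
move=> H; apply/subspace_valL_continuousP' => x.
have /diff_quot_cvgP /(_ 1 ltr01)[d d0 dP] := H x.
move=> W /nbhs_ballP[e /= e0 eW]; apply/nbhs_itvP.
pose M := `|u' x| + 1.
have M0 : 0 < M by rewrite ltr_wpDl.
exists (Num.min d (e / M)); first by rewrite lt_min d0 divr_gt0.
move=> y; rewrite lt_min => /andP[yd]; rewrite ltr_pdivlMr // => yM.
apply: eW; rewrite /ball /=.
have [->|yx] := eqVneq y x; first by rewrite subrr normr0.
have yx' : \val y - \val x != 0 by rewrite subr_eq0; apply: contra_neq yx => /val_inj.
rewrite distrC; apply: le_lt_trans yM.
have -> : u y - u x = (\val y - \val x) * diff_quot u x y.
  by rewrite /diff_quot mulrC divfK.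
rewrite normrM ler_wpM2l //.
have := dP y yx yd; rewrite -(subrK (u' x) (diff_quot u x y)) => h.
apply: le_trans (ler_normD _ _) _; rewrite /M addrC lerD2l.
by move: h; rewrite addrK => /ltW.
Qed.

Lemma has_deriv_is_derive {R : realType} (a b : R) (u u' : itv_cc a b -> R) :
  has_deriv a b u u' ->
  forall x : R, x \in `]a, b[ -> is_derive x 1 (ext u) (ext u' x).
Proof.
move=> H x; rewrite in_itv /= => /andP[ax xb].
pose px := itv_pt a b x (ltW ax) (ltW xb).
have Hx : (fun h => h^-1 *: ((ext u \o shift x) (h *: (1 : R)) - ext u x)) @ 0^' -->
    ext u' x.
  apply/cvgrPdist_lt => e e0.
  have /diff_quot_cvgP /(_ e e0)[d d0 dP] := H px.
  (* Increments smaller than the distances to [a] and [b] keep [h + x] in [[a, b]], where [ext u]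
     agrees with [u]. *)
  apply/nbhs_ballP; exists (Num.min d (Num.min (x - a) (b - x))) => /=.
    by rewrite !lt_min d0 !subr_gt0 ax.
  move=> h; rewrite /ball /= sub0r normrN !lt_min => /and3P[hd ha hb] h0.
  have [h1 h2] : a <= h + x /\ h + x <= b.
    by move: ha hb; rewrite !ltr_norml => /andP[? ?] /andP[? ?]; split; lra.
  rewrite distrC (_ : h *: 1 = h); last by rewrite /GRing.scale /= mulr1.
  have := dP (itv_pt a b _ h1 h2); rewrite /diff_quot /= addrK.
  rewrite -(extE a b u px) -(extE a b u' px) -(extE a b u (itv_pt a b _ h1 h2)) /=.
  rewrite [X in X -> _]/= => /(_ _ hd); rewrite mulrC; apply.
  apply/eqP => /(congr1 val) /= /eqP; rewrite -subr_eq0 addrK => /eqP.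
  by move/eqP: h0.
apply: DeriveDef; first by apply/cvg_ex; exists (ext u' x).
by apply: cvg_lim; [exact: norm_hausdorff|exact: Hx].
Qed.

Lemma is_derive_has_deriv {R : realType} (a b : R) (f f' : R -> R) :
  (forall x : R, is_derive x 1 f (f' x)) ->
  has_deriv a b (fun x => f (\val x)) (fun x => f' (\val x)).
Proof.
move=> H x; apply/diff_quot_cvgP => e e0.
have [df fE] := H (\val x).
have : (fun h => h^-1 *: ((f \o shift (\val x)) (h *: (1 : R)) - f (\val x))) @ 0^' -->
    f' (\val x) by rewrite -fE; exact: df.
move=> /cvgrPdist_lt /(_ e e0) /nbhs_ballP[d /= d0 dP].
exists d => // y yx yd.
have yx' : \val y - \val x != 0 by rewrite subr_eq0; apply: contra_neq yx => /val_inj.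
have := dP (\val y - \val x); rewrite /ball /= sub0r normrN => /(_ yd yx').
rewrite (_ : (_ - _) *: 1 = \val y - \val x); last by rewrite /GRing.scale /= mulr1.
by rewrite subrK distrC /diff_quot mulrC.
Qed.

(** * Taylor expansion *)

Lemma is_derive_sub_pow {R : realType} (x t : R) k :
  is_derive t 1 (fun r => (x - r) ^+ k.+1) (- (k.+1%:R * (x - t) ^+ k)).
Proof.
have -> : (fun r => (x - r) ^+ k.+1) = (cst x - id) ^+ k.+1 :> (R -> R).
  by apply/funext => r; rewrite exprfctE.
apply: is_derive_eq; rewrite /GRing.scale /= sub0r.
by rewrite -mulr_natl !fctE; ring.
Qed.

Section taylor.
Context {R : realType} (a b : R) (n : nat) (W : nat -> itv_cc a b -> R).
Hypothesis W_deriv : forall k, (k <= n)%N -> has_deriv a b (W k) (W k.+1).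

(** The Taylor polynomial of degree [k] centred at [t] and evaluated at [x], viewed as a function of
    its centre. It equals [W 0] at [t = x]. *)
Definition taylor_at (x : R) k (t : R) : R :=
  \sum_(j < k.+1) ext (W j) t * (x - t) ^+ j / j`!%:R.

(** Differentiating in the centre, the contributions of consecutive terms cancel and only the top
    one is left. *)
Lemma taylor_at_derive x k t : (k <= n)%N -> t \in `]a, b[ ->
  is_derive t 1 (taylor_at x k) (ext (W k.+1) t * (x - t) ^+ k / k`!%:R).
Proof.
move=> kn tab; elim: k kn => [|k IHk] kn.
  have -> : taylor_at x 0 = ext (W 0).
    by apply/funext => r; rewrite /taylor_at big_ord1 expr0 mulr1 divr1.
  by rewrite expr0 mulr1 divr1; exact: (has_deriv_is_derive _ _ _ _ (W_deriv 0 kn)).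
have -> : taylor_at x k.+1 = taylor_at x k +
    (ext (W k.+1) * (fun r => (x - r) ^+ k.+1)) * cst (k.+1`!%:R^-1).
  by apply/funext => r; rewrite /taylor_at big_ord_recr.
have d1 := IHk (ltnW kn).
have d2 := has_deriv_is_derive _ _ _ _ (W_deriv k.+1 kn) t tab.
have d3 := is_derive_sub_pow x t k.
have d4 := is_deriveD d1 (is_deriveM (is_deriveM d2 d3)
  (is_derive_cst (k.+1`!%:R^-1 : R) t (1 : R))).
refine (is_derive_eq d4 _).
rewrite /GRing.scale /= factS natrM; field.
by rewrite pnatr_eq0 -lt0n fact_gt0 addrC natr1 pnatr_eq0.
Qed.

Lemma ext_within_continuous k : (k <= n)%N ->
  {within `[a, b], continuous (ext (W k))}.
Proof. by move=> kn; exact: has_deriv_continuous (W_deriv k kn). Qed.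

Lemma taylor_at_continuous x k : (k <= n)%N ->
  {within `[a, b], continuous (taylor_at x k)}.
Proof.
elim: k => [|k IHk] kn.
  have -> : taylor_at x 0 = ext (W 0).
    by apply/funext => r; rewrite /taylor_at big_ord1 expr0 mulr1 divr1.
  exact: ext_within_continuous.
have -> : taylor_at x k.+1 = taylor_at x k +
    (ext (W k.+1) * (fun r => (x - r) ^+ k.+1)) * cst (k.+1`!%:R^-1).
  by apply/funext => r; rewrite /taylor_at big_ord_recr.
move=> r; apply: (@continuousD R R (subspace `[a, b])).
  exact: (IHk (ltnW kn)).
apply: (@continuousM R (subspace `[a, b])); last exact: cst_continuous.
apply: (@continuousM R (subspace `[a, b])).
  exact: ext_within_continuous.
apply: continuous_subspaceT => s.
apply/differentiable_continuous/derivable1_diffP.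
by have [] := is_derive_sub_pow x s k.
Qed.

Lemma taylor_at_self k t : taylor_at t k t = ext (W 0) t.
Proof.
rewrite /taylor_at big_ord_recl expr0 mulr1 divr1 big1 ?addr0 // => j _.
by rewrite subrr expr0n /= mulr0 mul0r.
Qed.

Hypothesis W_sign : forall x, (-1) ^+ n.+1 * W n.+1 x <= 0.

(* On [t, s] the derivative of the Taylor polynomial with respect to its
   centre is the derivative of [(-1) ^+ n * W n] times a weight lying between
   [(t - x) ^+ n / n`!] and [(s - x) ^+ n / n`!]. *)
Lemma taylor_at_bounds x t s : a <= x -> x <= t -> t <= s -> s <= b ->
  let D r := (-1) ^+ n * ext (W n) r in
  (D s - D t) * ((t - x) ^+ n / n`!%:R) <= taylor_at x n s - taylor_at x n t /\
  taylor_at x n s - taylor_at x n t <= (D s - D t) * ((s - x) ^+ n / n`!%:R).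
Proof.
move=> ax xt ts sb D.
have sub : `[t, s] `<=` `[a, b] by apply: subset_itv; rewrite bnd_simp //; lra.
have suboo r : r \in `]t, s[ -> r \in `]a, b[.
  by rewrite !in_itv /= => /andP[tr rs]; apply/andP; split; lra.
have nf0 : 0 < n`!%:R^-1 :> R by rewrite invr_gt0 ltr0n fact_gt0.
(* The derivative of [f c] has the sign of [(r - x) ^+ n - c], up to a nonnegative factor. With
   [c = (t - x) ^+ n] the function increases on [[t, s]], with [c = (s - x) ^+ n] it decreases. *)
pose f c := taylor_at x n - (ext (W n) * cst ((-1) ^+ n * (c / n`!%:R))).
have fc c : {within `[t, s], continuous (f c)}.
  apply: continuous_subspaceW sub _ => r.
  apply: (@continuousB R R (subspace `[a, b])); first exact: taylor_at_continuous.
  apply: (@continuousM R (subspace `[a, b])); last exact: cst_continuous.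
  exact: ext_within_continuous.
have fd c r : r \in `]t, s[ -> is_derive r 1 (f c)
    ((-1) ^+ n * ext (W n.+1) r * (((r - x) ^+ n - c) / n`!%:R)).
  move=> /suboo rab.
  have d1 := taylor_at_derive x n r (leqnn n) rab.
  have d2 := has_deriv_is_derive _ _ _ _ (W_deriv n (leqnn n)) r rab.
  apply: (is_derive_eq (is_deriveB d1 (is_deriveM d2
    (is_derive_cst ((-1) ^+ n * (c / n`!%:R) : R) r (1 : R))))).
  rewrite /GRing.scale /= mulr0 add0r.
  have -> : (x - r) ^+ n = (-1) ^+ n * (r - x) ^+ n.
    by rewrite -(opprB r x) [LHS]exprNn.
  by move: ((-1) ^+ n) ((r - x) ^+ n) => e y; ring.
have D'ge0 r : r \in `]t, s[ -> 0 <= (-1) ^+ n * ext (W n.+1) r.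
  move=> /suboo; rewrite in_itv /= => /andP[/ltW ar /ltW rb].
  have := W_sign (itv_pt a b r ar rb).
  by rewrite -(extE a b (W n.+1) (itv_pt a b r ar rb)) exprS /=; lra.
have fE c r : f c r = taylor_at x n r - D r * (c / n`!%:R).
  rewrite /D (_ : f c r = taylor_at x n r - ext (W n) r * ((-1) ^+ n * (c / n`!%:R))) //.
  ring.
split.
  have := @ger0_derive1_le_cc R (f ((t - x) ^+ n)) t s _ _ (fc _) t s.
  rewrite !fE !in_itv /= !lexx ts /= => H.
  suff : taylor_at x n t - D t * ((t - x) ^+ n / n`!%:R) <=
    taylor_at x n s - D s * ((t - x) ^+ n / n`!%:R) by lra.
  apply: H => // r rts; have [dr dE] := fd ((t - x) ^+ n) r rts => //.
  rewrite derive1E dE; apply: mulr_ge0; first exact: D'ge0.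
  apply: mulr_ge0; last exact: ltW.
  rewrite subr_ge0.
  by move: rts; rewrite in_itv /= => /andP[? ?]; rewrite lerXn2r ?nnegrE; lra.
have := @ler0_derive1_le_cc R (f ((s - x) ^+ n)) t s _ _ (fc _) s t.
rewrite !fE !in_itv /= !lexx ts /= => H.
suff : taylor_at x n s - D s * ((s - x) ^+ n / n`!%:R) <=
  taylor_at x n t - D t * ((s - x) ^+ n / n`!%:R) by lra.
apply: H => // r rts; have [dr dE] := fd ((s - x) ^+ n) r rts => //.
rewrite derive1E dE; apply: mulr_ge0_le0; first exact: D'ge0.
apply: mulr_le0_ge0; last exact: ltW.
rewrite subr_le0.
by move: rts; rewrite in_itv /= => /andP[? ?]; rewrite lerXn2r ?nnegrE; lra.
Qed.

End taylor.

(** Induction on the decomposition of [P ^+ m.+2 - Q ^+ m.+2] as [P * (P ^+ m.+1 - Q ^+ m.+1) + (P -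
    Q) * Q ^+ m.+1], for the positive parts [P] and [Q]. *)
Lemma exprn_max0_lip {R : realType} (p q M : R) m : 0 <= M -> q <= p -> p <= M ->
  Num.max p 0 ^+ m.+1 - Num.max q 0 ^+ m.+1 <= m.+1%:R * (p - q) * M ^+ m.
Proof.
move=> M0 qp pM.
have [P0 PM Q0 QP PQ] : [/\ 0 <= Num.max p 0, Num.max p 0 <= M, 0 <= Num.max q 0,
    Num.max q 0 <= Num.max p 0 & Num.max p 0 - Num.max q 0 <= p - q].
  have [p0|p0] := leP p 0; have [q0|q0] := leP q 0; split; lra.
move: (Num.max p 0) (Num.max q 0) P0 PM Q0 QP PQ => P Q P0 PM Q0 QP PQ.
apply: (@le_trans _ _ (m.+1%:R * (P - Q) * M ^+ m)); last first.
  by apply: ler_wpM2r; [exact: exprn_ge0|exact: ler_wpM2l].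
elim: m => [|m IHm]; first by rewrite expr0 !expr1; lra.
have d0 : 0 <= P ^+ m.+1 - Q ^+ m.+1.
  by rewrite subr_ge0; apply: lerXn2r => //; rewrite nnegrE.
have h1 : P * (P ^+ m.+1 - Q ^+ m.+1) <= M * (m.+1%:R * (P - Q) * M ^+ m).
  apply: le_trans (ler_wpM2r d0 PM) _; exact: ler_wpM2l.
have h2 : (P - Q) * Q ^+ m.+1 <= (P - Q) * M ^+ m.+1.
  apply: ler_wpM2l; first by rewrite subr_ge0.
  by apply: lerXn2r; rewrite ?nnegrE //; exact: le_trans PM.
rewrite [P ^+ m.+2]exprS [Q ^+ m.+2]exprS -(natr1 m.+1).
move: h1 h2; rewrite [M ^+ m.+1]exprS.
move: (P ^+ m.+1) (Q ^+ m.+1) (M ^+ m) (m.+1%:R : R) => x y z c; lra.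
Qed.

(** * Taylor's formula at [b] as a mixture of ramps *)

Section ladder.
Context {R : realType} (a b : R) (ab : a < b) (m : nat).
Context (W : nat -> itv_cc a b -> R).
Hypothesis W_deriv : forall k, (k <= m.+1)%N -> has_deriv a b (W k) (W k.+1).
Hypothesis W_sign : forall k x, (0 < k <= m.+2)%N -> (-1) ^+ k * W k x <= 0.

Let pb : itv_cc a b := itv_pt a b b (ltW ab) (lexx b).
Let D (r : R) := (-1) ^+ m.+1 * ext (W m.+1) r.

Lemma top_deriv_le0 r : a <= r -> r <= b -> D r <= 0.
Proof.
move=> ar rb; rewrite /D (extE a b (W m.+1) (itv_pt a b r ar rb) : ext _ r = _).
by apply: W_sign; rewrite /= leqW.
Qed.

Lemma top_deriv_mono p q : a <= p -> p <= q -> q <= b -> D p <= D q.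
Proof.
move=> ap; rewrite le_eqVlt => /predU1P[->//|pq] qb.
have Ws y : (-1) ^+ m.+2 * W m.+2 y <= 0 by apply: W_sign; rewrite leqnn.
have [l r] := taylor_at_bounds a b m.+1 W W_deriv Ws p p q ap (lexx p) (ltW pq) qb.
have := le_trans l r; rewrite subrr expr0n /= mul0r mulr0 pmulr_lge0 ?subr_ge0 //.
by rewrite divr_gt0 ?exprn_gt0 ?subr_gt0 // ltr0n fact_gt0.
Qed.

(* Freezing the centre at x once it drops below x makes the bounds of
   [taylor_at_bounds] valid on the whole of [a, b]. *)
Lemma taylor_max_bounds (x t s : R) : a <= x -> x <= b -> a <= t -> t <= s -> s <= b ->
  let H r := taylor_at a b W x m.+1 (Num.max r x) in
  let Q y := Num.max (y - x) 0 ^+ m.+1 / m.+1`!%:R in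
  (D s - D t) * Q t <= H s - H t /\ H s - H t <= (D s - D t) * Q s.
Proof.
move=> ax xb at_ ts sb H Q.
have Ws y : (-1) ^+ m.+2 * W m.+2 y <= 0 by apply: W_sign; rewrite leqnn.
have B := taylor_at_bounds a b m.+1 W W_deriv Ws x.
have Dm p q : a <= p -> p <= q -> q <= b -> D p <= D q by exact: top_deriv_mono.
have QE y : y <= x -> Q y = 0.
  by move=> yx; rewrite /Q max_r ?subr_le0 // expr0n /= mul0r.
have QE' y : x <= y -> Q y = (y - x) ^+ m.+1 / m.+1`!%:R.
  by move=> yx; rewrite /Q max_l // subr_ge0.
have [sx|xs] := leP s x.
  have tx := le_trans ts sx.
  by rewrite /H !max_r // !QE // subrr !mulr0.
have [xt|tx] := leP x t.
  have := B t s ax xt ts sb; rewrite /H !QE' // ?(ltW xs) //.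
  by rewrite (max_l (ltW xs)) (max_l xt).
have [] := B x s ax (lexx x) (ltW xs) sb; rewrite -/(D s) -/(D x) => B1 B2.
rewrite (QE t) ?(ltW tx) // (QE' s) ?(ltW xs) // /H (max_l (ltW xs)) (max_r (ltW tx)).
move: B1; rewrite subrr expr0n /= mul0r !mulr0 => B1; split => //.
apply: le_trans B2 _; apply: ler_wpM2r.
  by rewrite divr_ge0 // exprn_ge0 // subr_ge0 ltW.
by rewrite lerD2l lerN2; apply: Dm => //; exact: ltW.
Qed.


Hypothesis W_end : forall k, (0 < k < m.+1)%N -> W k pb = 0.

Lemma taylor_at_end x : taylor_at a b W x m.+1 b =
  W 0%N pb + D b * (b - x) ^+ m.+1 / m.+1`!%:R.
Proof.
have wE k : ext (W k) b = W k pb by rewrite -(extE a b (W k) pb).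
rewrite /taylor_at big_ord_recr big_ord_recl /= expr0 mulr1 divr1 wE big1.
  rewrite addr0 /D; congr (_ + _ / _).
  by rewrite -(opprB b x) [in LHS]exprNn mulrA [_ * ext _ _]mulrC.
by move=> [i im] _ /=; rewrite wE W_end ?mul0r //= /bump /=.
Qed.

(** Once the derivatives below order [m.+1] vanish at [b], [W 0] is a constant plus a multiple of
    the ramp at [b] minus a Stieltjes integral of ramps with respect to [D]. A Riemann sum with
    right endpoints lies in the cone, and approximates the integral uniformly in [x]. *)
Lemma ladder_clcone : clcone a b m.+1 (W 0%N).
Proof.
apply/closure_ptwsP => s e e0.
(* [L / N%:R] is the bound of [exprn_max0_lip] for the variation of the normalized ramp over one
   grid cell; the total error is at most [D b - D a] times this. *)
pose L := m.+1%:R * (b - a) * (b - a) ^+ m / m.+1`!%:R.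
have ba0 : 0 < b - a by rewrite subr_gt0.
have L0 : 0 <= L by rewrite /L !mulr_ge0 ?exprn_ge0 // ?invr_ge0 // ltW.
have DD0 : 0 <= D b - D a by rewrite subr_ge0 top_deriv_mono // ltW.
pose N := (Num.bound ((D b - D a) * L / e)).+1.
have N0 : 0 < N%:R :> R by rewrite ltr0n.
have NL : (D b - D a) * (L / N%:R) < e.
  rewrite mulrA ltr_pdivrMr // [e * _]mulrC -ltr_pdivrMr //.
  have X0 : 0 <= (D b - D a) * L / e.
    by apply: divr_ge0; [exact: mulr_ge0|exact: ltW].
  by apply: lt_le_trans (archi_boundP X0) _; rewrite ler_nat leqnSn.
pose t i := a + (b - a) * (i%:R / N%:R).
have t0 : t 0%N = a by rewrite /t mul0r mulr0 addr0.
have tN : t N = b by rewrite /t divff ?gt_eqF // mulr1 addrC subrK.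
have tS i : t i.+1 - t i = (b - a) / N%:R.
  by rewrite /t opprD addrACA subrr add0r -mulrBr -mulrBl -natr1 [_ + 1]addrC addrK mul1r.
have tle i : t i <= t i.+1 by rewrite -subr_ge0 tS divr_ge0 // ltW.
have tm i j : (i <= j)%N -> t i <= t j.
  by move=> ij; rewrite /t lerD2l ler_pM2l // ler_pM2r ?invr_gt0 // ler_nat.
have ta i : a <= t i by rewrite -t0 tm.
have tb i : (i <= N)%N -> t i <= b by move=> iN; rewrite -tN tm.
pose dD i := D (t i.+1) - D (t i).
have dD0 i : (i < N)%N -> 0 <= dD i.
  by move=> iN; rewrite subr_ge0 top_deriv_mono // tb.
have sumD : \sum_(i < N) dD i = D b - D a.
  rewrite -(big_mkord predT dD) telescope_sumr // tN t0 //.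
pose Q x i := Num.max (t i - x) 0 ^+ m.+1 / m.+1`!%:R.
pose p (x : itv_cc a b) := W 0%N pb + D b * (b - \val x) ^+ m.+1 / m.+1`!%:R -
  \sum_(i < N) dD i * Q (\val x) i.+1.
have fct0 : 0 <= m.+1`!%:R^-1 :> R by rewrite invr_ge0.
exists p.
  have -> : p = (fun x => (W 0%N pb + - (- D b / m.+1`!%:R * Num.max (b - \val x) 0 ^+ m.+1)) +
      \sum_(i < N) - (dD i / m.+1`!%:R * Num.max (t i.+1 - \val x) 0 ^+ m.+1)).
    apply/funext => x; rewrite /p sumrN; congr (_ + _ - _).
      rewrite max_l ?subr_ge0; last by case: (itv_ptP a b x).
      by rewrite !mulNr opprK mulrAC.
    by apply: eq_bigr => i _; rewrite /Q mulrA mulrAC.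
  apply: ramp_cone_add.
    apply: ramp_cone_add; first exact: ramp_cone_cst.
    apply: ramp_cone_ramp; first by rewrite in_itv /= lexx ltW.
    by rewrite mulr_ge0 // oppr_ge0 top_deriv_le0 // ltW.
  apply: (ramp_cone_sum a b m.+1 N
    (fun i x => - (dD i / m.+1`!%:R * Num.max (t i.+1 - \val x) 0 ^+ m.+1))) => i iN.
  apply: ramp_cone_ramp; last by rewrite mulr_ge0 // dD0.
  by rewrite in_itv /= ta tb.
move=> x _; have [ax xb] := itv_ptP a b x.
(* [H a] is [W 0 x] and [H b] is the Taylor polynomial centred at [b], so the increments of [H] over
   the grid add up to the integral term. *)
pose H r := taylor_at a b W (\val x) m.+1 (Num.max r (\val x)).
have B i : (i < N)%N -> dD i * Q (\val x) i <= H (t i.+1) - H (t i) /\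
    H (t i.+1) - H (t i) <= dD i * Q (\val x) i.+1.
  move=> iN; apply: taylor_max_bounds => //; exact: tb.
have W0E : W 0%N x = W 0%N pb + D b * (b - \val x) ^+ m.+1 / m.+1`!%:R -
    \sum_(i < N) (H (t i.+1) - H (t i)).
  rewrite -(big_mkord predT (fun i => H (t i.+1) - H (t i))).
  rewrite (telescope_sumr (fun i => H (t i))) // tN t0 /H (max_l xb) (max_r ax).
  by rewrite taylor_at_end taylor_at_self extE; ring.
have dE : W 0%N x - p x =
    \sum_(i < N) (dD i * Q (\val x) i.+1 - (H (t i.+1) - H (t i))).
  by rewrite [RHS]sumrB W0E /p; ring.
rewrite distrC dE ger0_norm; last first.
  by apply: sumr_ge0 => i _; rewrite subr_ge0; have [] := B i (ltn_ord i).
apply: le_lt_trans NL; rewrite -sumD mulr_suml; apply: ler_sum => i _.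
apply: (@le_trans _ _ (dD i * (Q (\val x) i.+1 - Q (\val x) i))).
  by rewrite mulrBr lerD2l lerN2; have [] := B i (ltn_ord i).
apply: ler_wpM2l; first exact: dD0.
rewrite /Q -mulrBl.
have := exprn_max0_lip (t i.+1 - \val x) (t i - \val x) (b - a) m (ltW ba0).
have -> : t i.+1 - \val x - (t i - \val x) = (b - a) / N%:R by rewrite -(tS i); ring.
move=> /(_ _ _)/(ler_wpM2r fct0) h; apply: le_trans (h _ _) _.
- by rewrite lerD2r.
- by apply: lerB => //; exact: tb.
by rewrite /L le_eqVlt; apply/orP; left; apply/eqP; ring.
Qed.
End ladder.

(** * Vanishing of the intermediate derivatives at [b] *)

Section end_derivatives.
Context {R : realType} (a b : R) (ab : a < b) (m : nat).
Context (W : nat -> itv_cc a b -> R).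
Hypothesis W_deriv : forall k, (k <= m.+1)%N -> has_deriv a b (W k) (W k.+1).
Hypothesis W_sign : forall k x, (0 < k <= m.+2)%N -> (-1) ^+ k * W k x <= 0.

Let pb : itv_cc a b := itv_pt a b b (ltW ab) (lexx b).

(* In the Taylor expansion at [b] all terms of [W 0 pb - W 0 x] are
   nonnegative. *)
Lemma taylor_term_le k x : (0 < k < m.+2)%N ->
  - ((-1) ^+ k * W k pb) * (b - \val x) ^+ k / k`!%:R <= W 0%N pb - W 0%N x.
Proof.
move=> /andP[k0 km]; have [ax xb] := itv_ptP a b x.
have wE j : ext (W j) b = W j pb by rewrite -(extE a b (W j) pb).
have [+ _] := taylor_max_bounds a b m W W_deriv W_sign (\val x) a b ax xb
  (lexx a) (ltW ab) (lexx b).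
rewrite (max_r ax) (max_l xb) taylor_at_self extE.
rewrite max_r ?subr_le0 // expr0n /= mul0r mulr0 subr_ge0 => T0.
have : W 0%N x <= W 0%N pb + (-1) ^+ k * W k pb * (b - \val x) ^+ k / k`!%:R.
  apply: le_trans T0 _; rewrite /taylor_at big_ord_recl /= expr0 mulr1 divr1 wE lerD2l.
  have [j kE] : exists j, k = j.+1 by exists k.-1; rewrite prednK.
  have jm : (j < m.+1)%N by rewrite -ltnS -kE.
  have tE (i : nat) : ext (W i.+1) b * (\val x - b) ^+ i.+1 / i.+1`!%:R =
      (-1) ^+ i.+1 * W i.+1 pb * ((b - \val x) ^+ i.+1 / i.+1`!%:R).
    rewrite wE (_ : (\val x - b) ^+ i.+1 = (-1) ^+ i.+1 * (b - \val x) ^+ i.+1).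
      by ring.
    by rewrite -(opprB b (\val x)) [LHS]exprNn.
  rewrite (bigD1 (Ordinal jm)) //= /bump /= tE kE -!mulrA gerDl.
  apply: sumr_le0 => i _; rewrite tE; apply: mulr_le0_ge0.
    by apply: W_sign; rewrite /= ltnS ltnW // ltnS; case: i.
  by rewrite divr_ge0 ?exprn_ge0 ?subr_ge0.
by rewrite !mulNr; lra.
Qed.

(** The chord from [a] to [b] of the convex root shows that [W 0 pb - W 0 x] is of order
    [(b - x) ^+ m.+1]. By [taylor_term_le] a nonzero derivative of order [k < m.+1] would force at
    least the order [(b - x) ^+ k]. *)
Lemma LP_end_derivatives : LP m.+1 a b (W 0%N) ->
  forall k, (0 < k < m.+1)%N -> W k pb = 0.
Proof.
move=> [le_ub cvx _] k /andP[k0 km].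
have wE : ext (W 0%N) b = W 0%N pb by rewrite -(extE a b (W 0%N) pb).
pose pa : itv_cc a b := itv_pt a b a (lexx a) (ltW ab).
have ba0 : 0 < b - a by rewrite subr_gt0.
have growth x : W 0%N pb - W 0%N x <=
    ((b - \val x) / (b - a)) ^+ m.+1 * (W 0%N pb - W 0%N pa).
  have [ax xb] := itv_ptP a b x.
  have t0 : 0 <= (b - \val x) / (b - a) by rewrite divr_ge0 ?subr_ge0 // ltW.
  have t1 : (b - \val x) / (b - a) <= 1.
    by rewrite ler_pdivrMr // mul1r lerD2l lerN2.
  have xE : \val x = (b - \val x) / (b - a) * a + (1 - (b - \val x) / (b - a)) * b.
    by field; rewrite gt_eqF.
  have := cvx (Itv01 t0 t1) a b _ _; rewrite !inE /= !in_itv /= !lexx (ltW ab).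
  move=> /(_ isT isT) C.
  have {C} : (W 0%N pb - W 0%N x) `^ m.+1%:R^-1 <=
      (b - \val x) / (b - a) * (W 0%N pb - W 0%N pa) `^ m.+1%:R^-1.
    have : (ext (W 0%N) b - ext (W 0%N) ((b - \val x) / (b - a) * a +
        (1 - (b - \val x) / (b - a)) * b)) `^ m.+1%:R^-1 <=
      (b - \val x) / (b - a) * (ext (W 0%N) b - ext (W 0%N) a) `^ m.+1%:R^-1 +
      (1 - (b - \val x) / (b - a)) * (ext (W 0%N) b - ext (W 0%N) b) `^ m.+1%:R^-1.
      exact: C.
    rewrite -xE subrr powR0 ?invr_eq0 ?pnatr_eq0 // mulr0 addr0 wE extE.
    by rewrite -(extE a b (W 0%N) pa).
  move=> C.
  have ux0 y : 0 <= W 0%N pb - W 0%N y by rewrite subr_ge0 -wE.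
  rewrite -(powR_invnK (W 0%N pb - W 0%N x) m) // -(powR_invnK (W 0%N pb - W 0%N pa) m) //.
  rewrite -exprMn lerXn2r ?nnegrE ?powR_ge0 //.
  by rewrite mulr_ge0 ?powR_ge0.
pose A := - ((-1) ^+ k * W k pb).
have A0 : 0 <= A by rewrite oppr_ge0 W_sign // k0 /= ltnW // ltnW.
suff Ale0 : A <= 0.
  have : A == 0 by rewrite eq_le Ale0.
  by rewrite oppr_eq0 mulf_eq0 signr_eq0 /= => /eqP.
rewrite leNgt; apply/negP => Agt0.
have f0 : 0 < k`!%:R :> R by rewrite ltr0n fact_gt0.
pose G := (W 0%N pb - W 0%N pa) / (b - a) ^+ m.+1.
have G0 : 0 <= G.
  by rewrite divr_ge0 ?exprn_ge0 ?(ltW ba0) // subr_ge0 -wE.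
(* [y] is the distance from [b] of the test point. The two bounds give [A / k]! <= y *
   G[, which contradicts]y * (G + 1) <= A / k[!] as [y > 0]. *)
have [y [y0 y1 yba yA]] : exists y, [/\ 0 < y, y <= 1, y <= b - a &
    y * (G + 1) <= A / k`!%:R].
  have G1 : 0 < G + 1 by rewrite ltr_wpDl.
  exists (Num.min 1 (Num.min (b - a) (A / k`!%:R / (G + 1)))); split.
  - by rewrite !lt_min ltr01 ba0 /= !divr_gt0.
  - by rewrite ge_min lexx.
  - by rewrite !ge_min lexx orbT.
  - by rewrite -ler_pdivlMr // !ge_min lexx !orbT.
have ay : a <= b - y by lra.
have yb : b - y <= b by lra.
have := le_trans (taylor_term_le k (itv_pt a b _ ay yb) _) (growth (itv_pt a b _ ay yb)).
rewrite /= k0 ltnW // => /(_ isT); rewrite -/A opprB [b + _]addrC subrK.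
rewrite expr_div_n => H0.
have {H0} : y ^+ k * (A / k`!%:R) <= y ^+ k * (y ^+ (m - k).+1 * G).
  rewrite [leRHS]mulrA -exprD (_ : (k + (m - k).+1)%N = m.+1); last first.
    by rewrite addnS subnKC // -ltnS.
  by move: H0; congr (is_true (_ <= _)); rewrite /G; ring.
rewrite ler_pM2l ?exprn_gt0 // => H.
have : y ^+ (m - k).+1 <= y by rewrite exprS ler_piMr ?exprn_ile1 // ltW.
move=> /(ler_wpM2r G0) /(le_trans H); lra.
Qed.
End end_derivatives.

(** * Smoothing of ramps *)

(** For the square, the remainder of the first-order expansion lies between 0 and [h * h]. Higher
    powers follow by the product rule, since multiplying a positive power of [max y 0] by [y] or by
    [max y 0] gives the same result. *)
Lemma is_derive_max0 {R : realType} (x : R) j :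
  is_derive x 1 (fun y => Num.max y 0 ^+ j.+2) (j.+2%:R * Num.max x 0 ^+ j.+1).
Proof.
elim: j => [|j IHj].
  have Hx : (fun h => h^-1 *: (((fun y : R => Num.max y 0 ^+ 2) \o shift x) (h *: (1 : R)) -
      Num.max x 0 ^+ 2)) @ 0^' --> 2 * Num.max x 0.
    apply/cvgrPdist_lt => e e0; apply/nbhs_ballP; exists e => //= h.
    rewrite /ball /= sub0r normrN => he h0.
    rewrite (_ : h *: 1 = h); last by rewrite /GRing.scale /= mulr1.
    apply: le_lt_trans he; rewrite /GRing.scale /=.
    set M := Num.max (h + x) 0; set N := Num.max x 0.
    have -> : 2 * N - h^-1 * (M ^+ 2 - N ^+ 2) = - ((M ^+ 2 - N ^+ 2 - 2 * N * h) / h).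
      by field.
    rewrite normrN normrM normfV ler_pdivrMr ?normr_gt0 // -normrM.
    suff [B1 B2] : 0 <= M ^+ 2 - N ^+ 2 - 2 * N * h /\ M ^+ 2 - N ^+ 2 - 2 * N * h <= h * h.
      by rewrite !ger0_norm // -expr2 sqr_ge0.
    rewrite /M /N; have [hx|hx] := leP (h + x) 0; have [xx|xx] := leP x 0; split; nra.
  rewrite expr1; apply: DeriveDef; first by apply/cvg_ex; exists (2 * Num.max x 0).
  by apply: cvg_lim; [exact: norm_hausdorff|exact: Hx].
have -> : (fun y : R => Num.max y 0 ^+ j.+3) = id * (fun y => Num.max y 0 ^+ j.+2).
  apply/funext => y; rewrite exprS mulrfctE.
  by have [_|//] := leP y 0; rewrite expr0n /= !mulr0.
apply: (is_derive_eq (is_deriveM (is_derive_id x 1) IHj)).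
have E : x * Num.max x 0 ^+ j.+1 = Num.max x 0 ^+ j.+2.
  rewrite [RHS]exprS.
  by have [_|//] := leP x 0; rewrite expr0n /= !mulr0.
rewrite /GRing.scale /= mulr1 mulrCA E -[j.+3%:R](natr1 j.+2); ring.
Qed.

Lemma is_derive_max0_sub {R : realType} (c x : R) j :
  is_derive x 1 (fun y => Num.max (c - y) 0 ^+ j.+2)
    (- (j.+2%:R * Num.max (c - x) 0 ^+ j.+1)).
Proof.
have dg : is_derive x 1 (fun y : R => c - y) (- 1).
  by apply: (is_derive_eq (is_deriveB (is_derive_cst c x 1) (is_derive_id x 1))); rewrite sub0r.
have df := is_derive_max0 (c - x) j.
apply: (is_derive_eq (@is_derive1_comp _ (fun y => Num.max y 0 ^+ j.+2) (fun y => c - y) x _ _ df dg)).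
by rewrite mulrN1.
Qed.

(** The backward second difference, with step [h], of the [j]-th power of the positive part. *)
Definition diff2 {R : realType} (h : R) j (y : R) : R :=
  Num.max y 0 ^+ j - 2 * Num.max (y - h) 0 ^+ j + Num.max (y - 2 * h) 0 ^+ j.

(** The last derivative of a smoothed ramp is a multiple of [diff2 h 1]; this bound provides its
    continuity. *)
Lemma diff2_lipschitz {R : realType} (h p q : R) :
  `|diff2 h 1 p - diff2 h 1 q| <= 4 * `|p - q|.
Proof.
have L x y : `|Num.max x 0 - Num.max y 0| <= `|x - y| :> R.
  have := ler_norm (x - y); have := ler_norm (y - x); rewrite (distrC y x).
  move: `|x - y| => N ? ?; rewrite ler_norml.
  by have [x0|x0] := leP x 0; have [y0|y0] := leP y 0; lra.
have := L p q; have := L (p - h) (q - h); have := L (p - 2 * h) (q - 2 * h).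
rewrite /diff2 !expr1 (_ : p - 2 * h - (q - 2 * h) = p - q); last by ring.
rewrite (_ : p - h - (q - h) = p - q); last by ring.
move: (Num.max p 0) (Num.max q 0) (Num.max (p - h) 0) (Num.max (q - h) 0)
  (Num.max (p - 2 * h) 0) (Num.max (q - 2 * h) 0) => p0 q0 p1 q1 p2 q2.
by rewrite !ler_norml => /andP[? ?] /andP[? ?] /andP[? ?]; apply/andP; split; lra.
Qed.

(** Midpoint convexity of powers of the positive part, [y - h] being the midpoint of [y] and
    [y - 2 * h]. *)
Lemma diff2_ge0 {R : realType} (h y : R) j : 0 <= diff2 h j.+1 y.
Proof.
have mx0 w : 0 <= Num.max w 0 :> R by rewrite le_max lexx orbT.
have := exprn_convex 2^-1 (Num.max y 0) (Num.max (y - 2 * h) 0) j.+1 _ _ (mx0 _) (mx0 _).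
have -> : 1 - 2^-1 = 2^-1 :> R by field.
move=> /(_ ltac:(lra) ltac:(lra)) B.
have : Num.max (y - h) 0 ^+ j.+1 <=
    (2^-1 * Num.max y 0 + 2^-1 * Num.max (y - 2 * h) 0) ^+ j.+1.
  apply: lerXn2r; rewrite ?nnegrE ?addr_ge0 ?mulr_ge0 ?invr_ge0 //.
  by have [?|?] := leP (y - h) 0; have [?|?] := leP y 0;
    have [?|?] := leP (y - 2 * h) 0; lra.
rewrite /diff2; move: B; move: (Num.max y 0 ^+ j.+1) => P; lra.
Qed.

(** Two applications of the mean value theorem turn the second difference into [c] times a ramp
    power at some [z2] between [y - 2 * h] and [y], and this power is monotone. *)
Lemma diff2_bounds {R : realType} (h y : R) m : 0 < h ->
  let c := m.+3%:R * m.+2%:R * h ^+ 2 in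
  c * Num.max (y - 2 * h) 0 ^+ m.+1 <= diff2 h m.+3 y /\
  diff2 h m.+3 y <= c * Num.max y 0 ^+ m.+1.
Proof.
move=> h0 c.
pose Q j (z : R) : R := Num.max z 0 ^+ j.
have dQ j (z w : R) : is_derive z 1 (fun z : R => Q j.+2 (z - w)) (j.+2%:R * Q j.+1 (z - w)).
  have dg : is_derive z 1 (fun y : R => y - w) 1.
    by apply: (is_derive_eq (is_deriveB (is_derive_id z 1) (is_derive_cst w z 1))); rewrite subr0.
  have df := is_derive_max0 (z - w) j.
  apply: (is_derive_eq (@is_derive1_comp _ (Q j.+2) (fun y => y - w) z _ _ df dg)).
  by rewrite mulr1.
have dQ0 j (z : R) : is_derive z 1 (Q j.+2) (j.+2%:R * Q j.+1 z) by exact: is_derive_max0.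
have step (f f' : R -> R) (p q : R) : (forall z : R, is_derive z 1 f (f' z)) -> p <= q ->
    exists2 z, z \in `[p, q] & f q - f p = f' z * (q - p).
  move=> df pq; apply: MVT_segment => //.
  apply: continuous_subspaceT => s.
  apply/differentiable_continuous/derivable1_diffP.
  by have [] := df s.
have dG (z : R) : is_derive z 1 (fun z : R => Q m.+3 z - Q m.+3 (z - h))
    (m.+3%:R * (Q m.+2 z - Q m.+2 (z - h))).
  by apply: (is_derive_eq (is_deriveB (dQ0 m.+1 z) (dQ m.+1 z h))); rewrite mulrBr.
have [z1 z1P E1] := step _ _ (y - h) y dG (ltac:(lra) : y - h <= y).
have [z2 z2P E2] := step _ _ (z1 - h) z1 (dQ0 m) (ltac:(lra) : z1 - h <= z1).
have -> : diff2 h m.+3 y = c * Q m.+1 z2.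
  have -> : diff2 h m.+3 y = (Q m.+3 y - Q m.+3 (y - h)) -
      (Q m.+3 (y - h) - Q m.+3 (y - h - h)).
    by rewrite /diff2 -/(Q _ _) (_ : y - 2 * h = y - h - h); [rewrite /Q|]; ring.
  by rewrite E1 E2 /c; ring.
have c0 : 0 <= c by apply: mulr_ge0; [exact: mulr_ge0|exact: sqr_ge0].
move: z1P z2P; rewrite !in_itv /= => /andP[l1 u1] /andP[l2 u2].
have Qm p q : p <= q -> Q m.+1 p <= Q m.+1 q.
  move=> pq; have mx0 w : (Num.max w 0 : R) \is Num.nneg.
    by rewrite nnegrE le_max lexx orbT.
  by apply: lerXn2r => //; rewrite ge_max !le_max pq lexx orbT.
by split; apply: ler_wpM2l => //; apply: Qm; lra.
Qed.

(** Membership in [U m.+1] with the derivatives given explicitly, plus their vanishing at [b] for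
    the orders strictly between 0 and [m.+1]. In this form sums are taken level by level. *)
Definition smooth_ladder {R : realType} (a b : R) m (w : itv_cc a b -> R) : Prop :=
  exists W : nat -> itv_cc a b -> R,
  [/\ W 0%N = w, forall k, (k <= m.+1)%N -> has_deriv a b (W k) (W k.+1),
    continuous (W m.+2), forall k x, (0 < k <= m.+2)%N -> (-1) ^+ k * W k x <= 0 &
    forall k (x : itv_cc a b), (0 < k < m.+1)%N -> \val x = b -> W k x = 0].

Lemma smooth_ladder_cst {R : realType} (a b : R) m (k : R) :
  smooth_ladder a b m (fun=> k).
Proof.
exists (fun j => if j is 0%N then fun=> k else fun=> 0); split => //.
- move=> j _; have -> : (if j is 0%N then fun=> k else fun=> 0) =
    (fun x : itv_cc a b => (cst (if j is 0%N then k else 0) : R -> R) (\val x)).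
    by case: j.
  apply: (is_derive_has_deriv a b _ (cst 0)) => x; exact: is_derive_cst.
- by move=> x; exact: cst_continuous.
- by move=> [|j] x //= _; rewrite mulr0.
- by case.
Qed.

Lemma has_deriv_add {R : realType} (a b : R) (u u' v v' : itv_cc a b -> R) :
  has_deriv a b u u' -> has_deriv a b v v' ->
  has_deriv a b (fun x => u x + v x) (fun x => u' x + v' x).
Proof.
move=> Hu Hv x; have FF : Filter x^' by exact: dnbhs_filter.
rewrite (_ : diff_quot _ x = (fun y => diff_quot u x y + diff_quot v x y)).
  by apply: cvgD; [exact: Hu|exact: Hv].
by apply/funext => y; rewrite /diff_quot -mulrDl opprD addrACA.
Qed.

Lemma smooth_ladder_add {R : realType} (a b : R) m (v w : itv_cc a b -> R) :
  smooth_ladder a b m v -> smooth_ladder a b m w ->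
  smooth_ladder a b m (fun x => v x + w x).
Proof.
move=> [V [<- Vd Vc Vs Ve]] [W [<- Wd Wc Ws We]].
exists (fun k x => V k x + W k x); split => //.
- by move=> k km; apply: has_deriv_add; [exact: Vd|exact: Wd].
- move=> x; apply: (@continuousD R R (itv_cc a b)); [exact: Vc|exact: Wc].
- by move=> k x km; rewrite mulrDr; have := Vs k x km; have := Ws k x km; lra.
- by move=> k x km xb; rewrite Ve // We // addr0.
Qed.

Lemma is_derive_diff2 {R : realType} (h c x : R) j :
  is_derive x 1 (fun y => diff2 h j.+2 (c - y)) (- (j.+2%:R * diff2 h j.+1 (c - x))).
Proof.
have d0 := is_derive_max0_sub c x j.
have d1 := is_derive_max0_sub (c - h) x j.
have d2 := is_derive_max0_sub (c - 2 * h) x j.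
have -> : (fun y => diff2 h j.+2 (c - y)) =
    (fun y => Num.max (c - y) 0 ^+ j.+2) -
    cst 2 * (fun y => Num.max (c - h - y) 0 ^+ j.+2) +
    (fun y => Num.max (c - 2 * h - y) 0 ^+ j.+2).
  apply/funext => y; rewrite /diff2 (addrAC c (- y)) (addrAC c (- y)).
  by [].
apply: (is_derive_eq (is_deriveD (is_deriveB d0
  (is_deriveM (is_derive_cst (2 : R) x (1 : R)) d1)) d2)).
rewrite /GRing.scale /= mulr0 addr0 /diff2.
rewrite (addrAC c (- x)) (addrAC c (- x)); ring.
Qed.

Lemma smooth_ladder_ramp {R : realType} (a b c r h : R) m :
  c \in `[a, b] -> 0 <= r -> 0 < h ->
  smooth_ladder a b m (fun x => - (r * diff2 h m.+3 (c - \val x))).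
Proof.
rewrite in_itv /= => /andP[ac cb] r0 h0.
(* The [k]-th derivative: every differentiation lowers the power by one and contributes a factor of
   the falling factorial and a sign from [c - t]. *)
pose F k (t : R) := - (r * ((-1) ^+ k * (m.+3 ^_ k)%:R)) * diff2 h (m.+3 - k) (c - t).
exists (fun k x => F k (\val x)); split.
- by apply/funext => x; rewrite /F subn0 expr0 ffactn0 mul1r mulr1 mulNr.
- move=> k km; apply: is_derive_has_deriv => x.
  have := is_derive_diff2 h c x (m.+1 - k).
  have E1 : (m.+1 - k).+2 = (m.+3 - k)%N by lia.
  have E2 : (m.+1 - k).+1 = (m.+3 - k.+1)%N by lia.
  rewrite E1 E2 => d.
  have -> : F k = cst (- (r * ((-1) ^+ k * (m.+3 ^_ k)%:R))) *
    (fun y => diff2 h (m.+3 - k) (c - y)) by [].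
  apply: (is_derive_eq (is_deriveM (is_derive_cst (_ : R) x (1 : R)) d)).
  rewrite /GRing.scale /= mulr0 addr0 /F ffactnSr natrM exprS.
  by move: ((-1) ^+ k) => s; ring.
- move=> x; apply: (@continuousM R (itv_cc a b)); first exact: cst_continuous.
  have E : (m.+3 - m.+2)%N = 1%N by lia.
  rewrite E => A /nbhs_ballP[e /= e0 eA]; apply/nbhs_itvP.
  exists (e / 4) => [|y yx]; first exact: divr_gt0.
  apply: eA; rewrite /ball /=.
  apply: le_lt_trans (diff2_lipschitz _ _ _) _; rewrite -ltr_pdivlMl //.
  by rewrite opprB addrC addrA subrK [_^-1 * _]mulrC.
- move=> k x /andP[_ km]; rewrite /F.
  have [j ->] : exists j, (m.+3 - k)%N = j.+1 by exists (m.+2 - k)%N; lia.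
  have s2 : (-1) ^+ k * (-1) ^+ k = 1 :> R by rewrite -expr2 sqrr_sign.
  have B0 := diff2_ge0 h (c - \val x) j.
  move: B0 s2; move: (diff2 _ _ _) ((-1) ^+ k) => B s B0 s2.
  have -> : s * (- (r * (s * (m.+3 ^_ k)%:R)) * B) = - (s * s * (r * (m.+3 ^_ k)%:R * B)).
    by ring.
  by rewrite s2 mul1r oppr_le0 !mulr_ge0.
- move=> k x /andP[_ km] xb; rewrite /F xb.
  have [j ->] : exists j, (m.+3 - k)%N = j.+1 by exists (m.+2 - k)%N; lia.
  (* Since [c <= b], the three positive parts in [diff2] are all 0 at [b]. *)
  have z y : y <= 0 -> Num.max y 0 ^+ j.+1 = 0 :> R.
    by move=> y0; rewrite max_r // expr0n.
  rewrite /diff2 !z ?mulr0 ?subr0 ?addr0 ?mulr0 //; lra.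
Qed.

(** * The closure of [U] and [LP] is the closed cone *)

Lemma derivn_on_ladder {R : realType} (a b : R) (ab : a < b) N
    (W : nat -> itv_cc a b -> R) :
  (forall k, (k < N)%N -> has_deriv a b (W k) (W k.+1)) ->
  forall k, (k <= N)%N -> derivn_on k (W 0%N) = W k.
Proof.
move=> Wd; elim=> [//|k IHk] kN.
rewrite /derivn_on iterS -/(derivn_on k (W 0%N)) IHk ?(ltnW kN) //.
by have [] := has_deriv_deriv_on a b ab _ _ (Wd k kN).
Qed.

Lemma smooth_ladder_U {R : realType} (a b : R) (ab : a < b) m w :
  smooth_ladder a b m w -> U m.+1 a b w.
Proof.
move=> [W [<- Wd Wc Ws _]].
have E := derivn_on_ladder a b ab m.+2 W (fun k km => Wd k km).
split; last by move=> k km x; rewrite E; [exact: Ws|case/andP: km].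
split=> [k km|]; last by rewrite E.
rewrite E ?(ltnW km) //.
by have [] := has_deriv_deriv_on a b ab _ _ (Wd k km).
Qed.

Lemma smooth_ladder_clcone {R : realType} (a b : R) (ab : a < b) m w :
  smooth_ladder a b m w -> clcone a b m.+1 w.
Proof.
move=> [W [<- Wd Wc Ws We]].
by apply: (ladder_clcone a b ab m W Wd Ws) => k km; exact: We.
Qed.

Lemma U_LP_clcone {R : realType} (a b : R) (ab : a < b) m u :
  U m.+1 a b u -> LP m.+1 a b u -> clcone a b m.+1 u.
Proof.
move=> [[ud uc] us] uLP.
pose W k := derivn_on k u.
have Wd k : (k <= m.+1)%N -> has_deriv a b (W k) (W k.+1).
  by move=> km; apply: derivable_on_has_deriv; exact: ud.
have Ws k x : (0 < k <= m.+2)%N -> (-1) ^+ k * W k x <= 0.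
  by move=> km; exact: us.
apply: (ladder_clcone a b ab m W Wd Ws).
exact: (LP_end_derivatives a b ab m W Wd Ws).
Qed.

(** Divided by [d], the second difference of the power [m.+3] lies between the ramp power [m.+1] and
    the same power with argument shifted by [2 * h]; the Lipschitz bound makes the gap uniformly
    small. *)
Lemma ramp_cone_smooth {R : realType} (a b : R) m v : ramp_cone a b m.+1 v ->
  forall e, 0 < e -> exists2 w, smooth_ladder a b m w & forall x, `|w x - v x| < e.
Proof.
elim=> [k|c r cab r0|f g _ IHf _ IHg] e e0.
- exists (fun=> k); first exact: smooth_ladder_cst.
  by move=> x; rewrite subrr normr0.
- have ba : 0 <= b - a.
    by move: cab; rewrite in_itv /= => /andP[ac cb]; rewrite subr_ge0 (le_trans ac).
  (* [C * h] is [r] times the Lipschitz bound for a shift of [2 * h] and arguments at most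
     [b - a]. *)
  pose C := r * (m.+1%:R * 2 * (b - a) ^+ m).
  have C0 : 0 <= C by rewrite /C !mulr_ge0 ?exprn_ge0.
  pose h := e / (C + 1).
  have h0 : 0 < h by rewrite divr_gt0 // ltr_wpDl.
  have Ch : C * h < e.
    by rewrite /h mulrA ltr_pdivrMr ?ltr_wpDl // [e * _]mulrC ltr_pM2r // ltrDl.
  pose d := m.+3%:R * m.+2%:R * h ^+ 2.
  have d0 : 0 < d by apply: mulr_gt0; [exact: mulr_gt0|exact: exprn_gt0].
  exists (fun x => - (r / d * diff2 h m.+3 (c - \val x))).
    by apply: smooth_ladder_ramp => //; rewrite divr_ge0 // ltW.
  move=> x; have [ax xb] := itv_ptP a b x.
  have [B1 B2] := diff2_bounds h (c - \val x) m h0.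
  have L := exprn_max0_lip (c - \val x) (c - \val x - 2 * h) (b - a) m ba _ _.
  apply: le_lt_trans Ch.
  have {}L : Num.max (c - \val x) 0 ^+ m.+1 - Num.max (c - \val x - 2 * h) 0 ^+ m.+1 <=
      m.+1%:R * 2 * (b - a) ^+ m * h.
    have h2 : c - \val x - 2 * h <= c - \val x by lra.
    have cba : c - \val x <= b - a.
      by move: cab; rewrite in_itv /= => /andP[ac cb]; apply: lerB.
    apply: le_trans (L h2 cba) _.
    by rewrite le_eqVlt; apply/orP; left; apply/eqP; ring.
  have -> : - (r / d * diff2 h m.+3 (c - \val x)) -
      - (r * Num.max (c - \val x) 0 ^+ m.+1) =
      r * (Num.max (c - \val x) 0 ^+ m.+1 - diff2 h m.+3 (c - \val x) / d) by ring.
  have E1 : diff2 h m.+3 (c - \val x) / d <= Num.max (c - \val x) 0 ^+ m.+1.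
    by rewrite ler_pdivrMr // mulrC.
  have E2 : Num.max (c - \val x - 2 * h) 0 ^+ m.+1 <= diff2 h m.+3 (c - \val x) / d.
    by rewrite ler_pdivlMr // mulrC.
  rewrite normrM (ger0_norm r0) ger0_norm ?subr_ge0 // /C -mulrA ler_wpM2l //.
  by apply: le_trans L; rewrite lerD2l lerN2.
- have [w1 w1s w1P] := IHf (e / 2) (divr_gt0 e0 (ltr0n _ 2)).
  have [w2 w2s w2P] := IHg (e / 2) (divr_gt0 e0 (ltr0n _ 2)).
  exists (fun x => w1 x + w2 x); first exact: smooth_ladder_add.
  move=> x; rewrite opprD addrACA [ltRHS](splitr e).
  by apply: le_lt_trans (ler_normD _ _) _; apply: ltrD.
Qed.

Lemma closure_U_LP {R : realType} (a b : R) (ab : a < b) m :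
  closure (U m.+1 a b `&` LP m.+1 a b : set {ptws itv_cc a b -> R}) =
  clcone a b m.+1.
Proof.
apply/seteqP; split=> u.
  move=> /closure_ptwsP cu; apply/closure_ptwsP => s e e0.
  have e20 : 0 < e / 2 by rewrite divr_gt0.
  have [v [vU vLP] vu] := cu s _ e20.
  have /closure_ptwsP cv := U_LP_clcone a b ab m v vU vLP.
  have [w wK wv] := cv s _ e20.
  exists w => // x xs; rewrite -(subrK (v x) (w x)) -addrA [ltRHS](splitr e).
  by apply: le_lt_trans (ler_normD _ _) _; apply: ltrD; [exact: wv|exact: vu].
move=> /closure_ptwsP cu; apply/closure_ptwsP => s e e0.
have e20 : 0 < e / 2 by rewrite divr_gt0.
have [v vK vu] := cu s _ e20.
have [w wS wv] := ramp_cone_smooth a b m v vK _ e20.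
exists w.
  split; first exact: smooth_ladder_U.
  by apply: clcone_LP => //; exact: smooth_ladder_clcone.
move=> x xs; rewrite -(subrK (v x) (w x)) -addrA [ltRHS](splitr e).
by apply: le_lt_trans (ler_normD _ _) _; apply: ltrD; [exact: wv|exact: vu].
Qed.

(** * The maximal generator *)

Lemma continuous_stieltjes_integrable {R : realType} (a b : R)
    (F : cumulativeBounded (0 : R) (1 : R)) (p : R -> R) :
  a <= b -> distribution_on a b F -> continuous p ->
  (lebesgue_stieltjes_measure F).-integrable `[a, b]%classic (EFin \o p).
Proof.
move=> ab dF cp; apply: measurable_bounded_integrable.
- exact: measurable_itv.
- apply: le_lt_trans (ltry 1); rewrite le_eqVlt; apply/orP; left; apply/eqP.
  exact: distribution_mass ab dF.
- by apply: measurable_funTS; exact: continuous_measurable_fun.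
- have cp' : {within `[a, b], continuous p} by exact: continuous_subspaceT.
  have [c _ pc] := EVT_max ab cp'; have [d _ pd] := EVT_min ab cp'.
  exists (`|p c| + `|p d|); split; first by rewrite num_real.
  move=> M lM x xab; apply: le_trans (ltW lM).
  have := pc x xab; have := pd x xab.
  have := ler_norm (p c); have := ler_norm (- p d); rewrite normrN.
  have := normr_ge0 (p c); have := normr_ge0 (p d).
  by move=> *; rewrite ler_norml; apply/andP; split; lra.
Qed.

Lemma stieltjes_cst {R : realType} (a b : R) F k : a <= b ->
  distribution_on a b F -> stieltjes a b F (fun=> k) = k%:E.
Proof.
move=> ab dF.
apply: (etrans (integral_cst (lebesgue_stieltjes_measure F)
  (measurable_itv `[a, b]) k%:E)).
by rewrite -[RHS]mule1; congr (_ * _)%E; exact: distribution_mass ab dF.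
Qed.

Lemma ramp_continuous {R : realType} (c : R) n :
  continuous (fun x : R => Num.max (c - x) 0 ^+ n).
Proof.
have cm : continuous (fun x : R => Num.max (c - x) 0).
  move=> y W /nbhs_ballP[e /= e0 eW]; apply/nbhs_ballP; exists e => //= z.
  rewrite /ball /= => yz; apply: eW; apply: le_lt_trans yz.
  rewrite (_ : y - z = (c - z) - (c - y)); last by ring.
  move: (c - z) (c - y) => p q; rewrite distrC.
  have := ler_norm (p - q); have := ler_norm (q - p); rewrite (distrC q p).
  move: `|p - q| => N ? ?; rewrite ler_norml.
  by have [?|?] := leP p 0; have [?|?] := leP q 0; apply/andP; split; lra.
elim: n => [|n IHn].
  rewrite (_ : (fun x => _) = cst 1); first by move=> x; exact: cst_continuous.
  by apply/funext => x; rewrite expr0.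
rewrite (_ : (fun x => _) = (fun x => Num.max (c - x) 0) *
  (fun x => Num.max (c - x) 0 ^+ n)).
  by move=> x; apply: (@continuousM R R); [exact: cm|exact: IHn].
by apply/funext => x; rewrite exprS.
Qed.

(** Constants have equal integrals because both masses are 1, and the case of ramps is the dominance
    hypothesis. A continuous [p] on the whole line replaces [ext v], so that integrability and
    measurability are immediate. *)
Lemma ramp_cone_stieltjes {R : realType} (a b : R) n F G : a <= b ->
  distribution_on a b F -> distribution_on a b G -> bsd n a b G F ->
  forall v, ramp_cone a b n v -> exists p : R -> R, [/\ continuous p,
    forall x, v x = p (\val x) & (stieltjes a b F p <= stieltjes a b G p)%E].
Proof.
move=> ab dF dG GF v.
have int (H : cumulativeBounded (0 : R) (1 : R)) (p : R -> R) :
    distribution_on a b H -> continuous p ->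
    (lebesgue_stieltjes_measure H).-integrable `[a, b]%classic (EFin \o p).
  by move=> dH cp; exact: continuous_stieltjes_integrable.
have mI : measurable (`[a, b]%classic : set (measurableTypeR R)).
  exact: measurable_itv.
elim=> [k|c r cab r0|f g _ [p [cp fp ip]] _ [q [cq gq iq]]].
- exists (cst k); split; [by move=> x; exact: cst_continuous|by []|].
  by rewrite (stieltjes_cst a b F k ab dF) (stieltjes_cst a b G k ab dG).
- pose q (x : R) : R := Num.max (c - x) 0 ^+ n.
  have cq : continuous q by exact: ramp_continuous.
  have st H : distribution_on a b H ->
      stieltjes a b H (fun x => - r * q x) = ((- r)%:E * stieltjes a b H q)%E.
    move=> dH.
    refine (etrans _ (integralZl mI (int H q dH cq) (- r))).
    by apply: eq_integral => x _; rewrite /= EFinM.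
  exists (fun x => - r * q x); split.
  + by move=> x; apply: (@continuousM R R (cst (- r)) q); [exact: cst_continuous|exact: cq].
  + by move=> x; rewrite mulNr.
  + have : (stieltjes a b G q <= stieltjes a b F q)%E := GF c cab.
    rewrite (st F dF) (st G dG); move: (stieltjes _ _ _ _) (stieltjes _ _ _ _) => X Y XY.
    by rewrite EFinN !mulNe leeN2; apply: lee_wpmul2l; rewrite ?lee_fin.
- exists (fun x => p x + q x); split.
  + by move=> x; apply: (@continuousD R R R p q); [exact: cp|exact: cq].
  + by move=> x; rewrite fp gq.
  + have st H : distribution_on a b H ->
        stieltjes a b H (fun x => p x + q x) = (stieltjes a b H p + stieltjes a b H q)%E.
      move=> dH.
      refine (etrans _ (integralD mI (int H p dH cp) (int H q dH cq))).
      by apply: eq_integral => x _; rewrite /= EFinD.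
    by rewrite (st F dF) (st G dG); exact: leeD.
Qed.

Lemma grid_cell {R : realType} (t : nat -> R) N x : (0 < N)%N ->
  t 0%N <= x -> x <= t N -> exists2 i, (i < N)%N & t i <= x <= t i.+1.
Proof.
case: N => // N _ t0x; elim: N => [|N IHN] xt; first by exists 0%N; rewrite ?t0x.
have [/IHN[i iN xi]|/ltW tx] := leP x (t N.+1); first by exists i => //; exact: ltnW.
by exists N.+1; rewrite ?tx.
Qed.

Lemma clcone_bounded {R : realType} (a b : R) (ab : a <= b) n u :
  clcone a b n u -> bounded_fun u.
Proof.
move=> cu.
pose pa := itv_pt a b a (lexx a) ab; pose pb := itv_pt a b b ab (lexx b).
exists (`|u pa| + `|u pb|); split; first by rewrite num_real.
move=> M lM x _ /=; apply: le_trans (ltW lM).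
have [ax xb] := itv_ptP a b x.
have := clcone_mono _ _ _ _ cu pa x ax; have := clcone_mono _ _ _ _ cu x pb xb.
have := ler_norm (u pb); have := ler_norm (- u pa); rewrite normrN.
have := normr_ge0 (u pa); have := normr_ge0 (u pb).
by move=> *; rewrite ler_norml; apply/andP; split; lra.
Qed.

Lemma clcone_measurable {R : realType} (a b : R) (ab : a <= b) n u :
  clcone a b n u -> measurable_fun `[a, b]%classic (ext u).
Proof.
move=> cu.
have ac x : a <= Num.max a (Num.min x b) by rewrite le_max lexx.
have cb x : Num.max a (Num.min x b) <= b by rewrite ge_max ab ge_min lexx orbT.
(* Clamping the argument gives a function nondecreasing on the whole line, which [ext u] need not be
   because of its value 0 outside [[a, b]]. *)
pose f x := u (itv_pt a b _ (ac x) (cb x)).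
have mf : measurable_fun `[a, b]%classic f.
  apply: nondecreasing_measurable; first exact: measurable_itv.
  move=> x y xy; apply: (clcone_mono _ _ _ _ cu) => /=.
  by rewrite ge_max !le_max lexx /= le_min !ge_min xy lexx !orbT.
apply: eq_measurable_fun mf => x /set_mem; rewrite /= in_itv /= => /andP[ax xb].
rewrite /f -(extE a b u (itv_pt a b _ (ac x) (cb x))) /=.
by rewrite (min_l xb) (max_r ax).
Qed.

(** The closure only yields approximation on finite sets, while dominated convergence needs a
    sequence. Elements of the cone close to [u] on finer and finer grids form one: monotonicity and
    the concavity of [u] control the points between grid points. *)
Lemma clcone_maximal_generator {R : realType} (a b : R) (ab : a < b) m u :
  clcone a b m.+1 u -> maximal_generator a b (bsd m.+1 a b) u.
Proof.
move=> cu; have ab' := ltW ab.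
split; [exact: clcone_bounded cu|exact: clcone_measurable cu|].
move=> F G dF dG GF.
pose pa := itv_pt a b a (lexx a) ab'; pose pb := itv_pt a b b ab' (lexx b).
pose t N i : R := a + (b - a) * (i%:R / N%:R).
have t0 N : t N 0%N = a by rewrite /t mul0r mulr0 addr0.
have tN N : t N.+1 N.+1 = b by rewrite /t divff ?pnatr_eq0 // mulr1 addrC subrK.
have tm N i j : (i <= j)%N -> t N i <= t N j.
  move=> ij; rewrite /t lerD2l ler_wpM2l ?subr_ge0 // ler_wpM2r ?invr_ge0 //.
  by rewrite ler_nat.
have ta N i : a <= t N i by rewrite -(t0 N) tm.
have tb N i : (i <= N.+1)%N -> t N.+1 i <= b by move=> iN; rewrite -(tN N) tm.
have approx k : exists p : R -> R, [/\ continuous p,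
    (forall x y, a <= x -> x <= y -> y <= b -> p x <= p y),
    (forall i, (i <= k.+1)%N -> `|p (t k.+1 i) - ext u (t k.+1 i)| < k.+1%:R^-1) &
    (stieltjes a b F p <= stieltjes a b G p)%E].
  pose s := [seq insubd pa (t k.+1 i) | i <- iota 0 k.+2].
  have [|v vK vu] := (closure_ptwsP R _ _ u).1 cu s k.+1%:R^-1.
    by rewrite invr_gt0.
  have [p [cp vp ip]] := ramp_cone_stieltjes a b m.+1 F G ab' dF dG GF v vK.
  exists p; split => //.
    move=> x y ax xy yb.
    have := clcone_mono a b m.+1 v (subset_closure vK)
      (itv_pt a b x ax (le_trans xy yb)) (itv_pt a b y (le_trans ax xy) yb) xy.
    by rewrite !vp.
  move=> i ik; have tab : t k.+1 i \in `[a, b]%classic.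
    by rewrite inE /= in_itv /= ta tb.
  have vE : \val (insubd pa (t k.+1 i)) = t k.+1 i by rewrite insubdK.
  have := vu (insubd pa (t k.+1 i)); rewrite vp -(extE a b u) vE; apply.
  by apply/mapP; exists i => //; rewrite mem_iota.
have [p pP] := choice approx.
have mI : measurable (`[a, b]%classic : set (measurableTypeR R)).
  exact: measurable_itv.
have um x y : a <= x -> x <= y -> y <= b -> ext u x <= ext u y.
  move=> ax xy yb.
  have := clcone_mono a b m.+1 u cu
      (itv_pt a b x ax (le_trans xy yb)) (itv_pt a b y (le_trans ax xy) yb) xy.
  by rewrite -!(extE a b u).
pose osc := ext u b - ext u a.
have osc0 : 0 <= osc by rewrite subr_ge0 um.
(* Concavity is the case [al = be = 1] of [clcone_root_convex]; it bounds the variation of [u] over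
   a cell away from [a]. *)
have conc x y : a <= x -> x <= y -> y <= b -> a < y ->
    ext u y - ext u x <= (y - x) / (y - a) * osc.
  move=> ax xy yb ay.
  have ya0 : 0 < y - a by rewrite subr_gt0.
  pose s := (y - x) / (y - a).
  have s0 : 0 <= s by rewrite divr_ge0 ?subr_ge0 // ltW.
  have s1 : s <= 1 by rewrite ler_pdivrMr // mul1r lerD2l lerN2.
  pose px := itv_pt a b x ax (le_trans xy yb); pose py := itv_pt a b y (ltW ay) yb.
  have xE : \val px = s * \val pa + (1 - s) * \val py.
    by rewrite /= /s; field; rewrite gt_eqF.
  have := clcone_root_convex a b m u cu pa py px pb s 1 1 erefl s0 s1 xE ltr01 ltr01.
  rewrite !mulr1 subrKC expr1n !divr1 mul1r -!(extE a b u) /=.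
  have := um y b (ltW ay) yb (lexx b); rewrite -/s /osc => ? ?.
  have : 0 <= s * (ext u b - ext u y) by rewrite mulr_ge0 // subr_ge0.
  lra.
have pu x : a <= x -> x <= b -> p k x @[k --> \oo] --> ext u x.
  move=> ax xb.
  (* At [a] concavity allows a jump of [u], but [a] belongs to every grid. Elsewhere the variation
     of [u] over the cell of [x] is added, a cell of length [(b - a) / k.+1%:R] whose right end is
     at least [x - a] away from [a]. *)
  pose C := if x == a then 1 else 1 + (b - a) / (x - a) * osc.
  have Cle k : `|p k x - ext u x| <= C * k.+1%:R^-1.
    have [cp pm pt _] := pP k.
    rewrite /C; have [->|xa] := eqVneq x a.
      by rewrite mul1r; have := pt 0%N isT; rewrite t0 => /ltW.
    have xa0 : a < x by rewrite lt_neqAle eq_sym xa.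
    have [||i ik /andP[tx xt]] := @grid_cell R (t k.+1) k.+1 x isT.
    - by rewrite t0.
    - by rewrite tN.
    have tib := tb k i.+1 ik; have tia := ta k.+1 i.
    have := pt _ (ltnW ik); have := pt _ ik; rewrite !ltr_norml.
    move=> /andP[A1 A2] /andP[A3 A4].
    have p1 := pm _ _ tia tx xb; have p2 := pm _ _ ax xt tib.
    have u1 := um _ _ tia tx xb; have u2 := um _ _ ax xt tib.
    pose D := (b - a) / (x - a) * osc * k.+1%:R^-1.
    have B : ext u (t k.+1 i.+1) - ext u (t k.+1 i) <= D.
      apply: le_trans (conc _ _ tia (le_trans tx xt) tib (lt_le_trans xa0 xt)) _.
      rewrite /D [leRHS]mulrAC; apply: ler_wpM2r => //.
      have -> : t k.+1 i.+1 - t k.+1 i = (b - a) / k.+1%:R.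
        rewrite /t opprD addrACA subrr add0r -mulrBr -mulrBl -natr1.
        by rewrite [i%:R + 1]addrC addrK mul1r.
      rewrite [leRHS]mulrAC ler_pM2l; last first.
        by rewrite divr_gt0 ?subr_gt0.
      by rewrite lef_pV2 ?posrE ?subr_gt0 ?lerD2r // (lt_le_trans xa0 xt).
    rewrite mulrDl mul1r ler_norml -/D; move: B A1 A2 A3 A4; clearbody D.
    move: (k.+1%:R^-1) => e B A1 A2 A3 A4.
    by apply/andP; split; lra.
  have C0 : 0 <= C.
    by have := Cle 0%N; rewrite invr1 mulr1; apply: le_trans.
  apply/cvgrPdist_le => e e0.
  have : C * (k.+1%:R^-1) @[k --> \oo] --> (C * 0 : R).
    by apply: cvgMr; exact: cvg_harmonic.
  rewrite mulr0 => /cvgrPdist_le /(_ e e0); apply: filterS => k.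
  rewrite sub0r normrN ger0_norm ?mulr_ge0 ?invr_ge0 // distrC.
  exact: le_trans.
pose B := `|ext u a| + `|ext u b| + 1.
have pB k x : a <= x -> x <= b -> `|p k x| <= B.
  move=> ax xb; have [_ pm pt _] := pP k.
  have := pm _ _ (lexx a) ax xb; have := pm _ _ ax xb (lexx b).
  have := pt 0%N isT; have := pt k.+1 (leqnn _); rewrite t0 tN.
  have k1 : k.+1%:R^-1 <= 1 :> R by rewrite invf_le1 ?ler1n.
  rewrite /B; have := ler_norm (ext u b); have := ler_norm (- ext u a).
  have := normr_ge0 (ext u a); have := normr_ge0 (ext u b); rewrite normrN.
  move: `|ext u b| `|ext u a| (k.+1%:R^-1) k1 => nb na e k1.
  rewrite !ltr_norml ler_norml => ? ? ? ? /andP[? ?] /andP[? ?] ? ?.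
  by apply/andP; split; lra.
have limH H : distribution_on a b H ->
    stieltjes a b H (p k) @[k --> \oo] --> stieltjes a b H (ext u).
  move=> dH.
  have [] // := @dominated_convergence _ _ _ (lebesgue_stieltjes_measure H)
    `[a, b]%classic mI (fun k => EFin \o p k) (EFin \o ext u) (EFin \o cst B).
  - move=> k; apply/measurable_EFinP; apply: measurable_funTS.
    by apply: continuous_measurable_fun; have [] := pP k.
  - by apply/measurable_EFinP; exact: clcone_measurable cu.
  - apply: aeW => x /= xab; apply: cvg_EFin; first by apply: nearW.
    by move: xab; rewrite in_itv /= => /andP[ax xb]; exact: pu.
  - apply: continuous_stieltjes_integrable => //.
    by move=> x; exact: cst_continuous.
  - apply: aeW => x k /=; rewrite in_itv /= => /andP[ax xb].
    by rewrite lee_fin pB.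
apply: lee_cvg_to (limH F dF) (limH G dG) _.
by apply: nearW => k; have [] := pP k.
Qed.

(** Only the values on the list [s] matter, so the separation takes place in a finite-dimensional
    space and the weights become finitely supported distributions. *)
Lemma maximal_generator_clcone {R : realType} (a b : R) (ab : a < b) n u :
  maximal_generator a b (bsd n a b) u -> clcone a b n u.
Proof.
move=> [_ mu gu]; apply/closure_ptwsP => s e e0.
pose N := size s; pose pa := itv_pt a b a (lexx a) (ltW ab).
pose x k := nth pa s k.
pose vec (v : itv_cc a b -> R) : 'rV[R]_N := \row_i v (x i).
pose C := vec @` ramp_cone a b n.
have [clu|nclu] := pselect (closure C (vec u)).
  have [_ [[v vK <-] vu]] := clu _ (nbhsx_ballx (vec u) e e0).
  exists v => // y ys; have iN : (index y s < N)%N by rewrite index_mem.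
  move: vu; rewrite /ball /= /mx_ball => -[_ /(_ 0 (Ordinal iN))].
  by rewrite /ball /= !mxE /x nth_index // distrC.
exfalso.
have [||||w wC wu] := nearest_point_separation R N C (vec u).
- exists (fun=> 0); first exact: ramp_cone_cst.
  by apply/rowP => i; rewrite !mxE.
- move=> _ _ [v vK <-] [v' vK' <-]; exists (fun y => v y + v' y).
    exact: ramp_cone_add.
  by apply/rowP => i; rewrite !mxE.
- move=> t _ t0 [v vK <-]; exists (fun y => t * v y).
    exact: ramp_cone_scale.
  by apply/rowP => i; rewrite !mxE.
- exact: nclu.
have {}wC v : ramp_cone a b n v -> \sum_i w 0 i * v (x i) <= 0.
  move=> vK; apply: le_trans (wC (vec v) _); last by exists v.
  by rewrite le_eqVlt; apply/orP; left; apply/eqP/eq_bigr => i _; rewrite mxE.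
have {}wu : 0 < \sum_i w 0 i * u (x i).
  by apply: lt_le_trans wu _; apply: ler_sum => i _; rewrite mxE.
(* The cone contains the constants 1 and -1. *)
have w0 : \sum_i w 0 i = 0.
  apply/eqP; rewrite eq_le; apply/andP; split.
    have := wC _ (ramp_cone_cst a b n 1).
    by under eq_bigr do rewrite mulr1.
  have := wC _ (ramp_cone_cst a b n (- 1)).
  by under eq_bigr do rewrite mulrN1; rewrite sumrN oppr_le0.
pose wp i := Num.max (w 0 i) 0; pose wm i := Num.max (- w 0 i) 0.
have wpm i : w 0 i = wp i - wm i.
  by rewrite /wp /wm; have [?|?] := leP (w 0 i) 0; have [?|?] := leP (- w 0 i) 0; lra.
have wp0 i : 0 <= wp i by rewrite le_max lexx orbT.
have wm0 i : 0 <= wm i by rewrite le_max lexx orbT.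
pose M := \sum_i wp i.
have ME : M = \sum_i wm i.
  apply/eqP; rewrite -subr_eq0 -sumrB; apply/eqP.
  by rewrite -[RHS]w0; apply: eq_bigr => i _; rewrite wpm.
(* If [M] were 0, all positive and negative parts would vanish, against [wu]. *)
have M0 : 0 < M.
  rewrite lt_neqAle sumr_ge0 // andbT; apply/eqP => M0.
  move: wu; rewrite big1 ?ltxx // => i _.
  have pi0 : wp i = 0 by apply: (psumr_eq0P _ (esym M0)).
  have mi0 : wm i = 0.
    by apply: (psumr_eq0P (F := wm) (P := predT)) => //; rewrite -ME.
  by rewrite wpm pi0 mi0 subrr mul0r.
have xab k : \val (x k) \in `[a, b].
  by rewrite in_itv /=; apply/andP; exact: itv_ptP.
have dist (v : 'I_N -> R) : (forall i, 0 <= v i) -> \sum_i v i = M ->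
    exists2 F : cumulativeBounded (0 : R) (1 : R), distribution_on a b F &
    forall f : R -> R, measurable_fun `[a, b]%classic f ->
    stieltjes a b F f = (M^-1 * \sum_i v i * f (\val (x i)))%:E.
  move=> v0 vM.
  (* Weights indexed by ordinals are extended by 0 to the sequences that [discrete_distribution]
     expects. *)
  pose vn k := if insub k is Some i then M^-1 * v i else 0.
  have vnE (i : 'I_N) : vn i = M^-1 * v i by rewrite /vn valK.
  have [k|||F dF FE] := discrete_distribution a b (fun k => \val (x k)) vn N.
  - exact: xab.
  - move=> k; rewrite /vn; case: insub => [i|//].
    by rewrite mulr_ge0 // invr_ge0 ltW.
  - under eq_bigr do rewrite vnE.
    by rewrite -mulr_sumr vM mulVf // gt_eqF.
  exists F => // f mf; rewrite FE // mulr_sumr; congr (_%:E).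
  by apply: eq_bigr => i _; rewrite vnE mulrA.
have [F dF FE] := dist wp wp0 erefl.
have [G dG GE] := dist wm wm0 (esym ME).
have wsplit f : \sum_i w 0 i * f (x i) =
    \sum_i wp i * f (x i) - \sum_i wm i * f (x i).
  by rewrite -sumrB; apply: eq_bigr => i _; rewrite wpm mulrBl.
have Mi0 : 0 < M^-1 by rewrite invr_gt0.
(* The separating inequality at the cone element with [r = 1]: the ramps enter the cone with a minus
   sign, so their integral is larger under [F], the distribution of the positive weights. *)
have GF : bsd n a b G F.
  move=> c cab.
  have mq : measurable_fun `[a, b]%classic (fun y : R => Num.max (c - y) 0 ^+ n).
    by apply: measurable_funTS; apply: continuous_measurable_fun; exact: ramp_continuous.
  rewrite FE // GE // lee_fin ler_pM2l // -subr_ge0.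
  rewrite -(wsplit (fun y => Num.max (c - \val y) 0 ^+ n)) -oppr_le0 -sumrN.
  apply: le_trans (wC _ (ramp_cone_ramp a b n c 1 cab ler01)).
  by apply: ler_sum => i _; rewrite mul1r mulrN.
have := gu F G dF dG GF; rewrite FE // GE // lee_fin ler_pM2l // -subr_le0.
under eq_bigr do rewrite extE.
under [X in _ - X]eq_bigr do rewrite extE.
by rewrite -(wsplit u) leNgt wu.
Qed.

Theorem corollary1 (R : realType) (a b : R) (hab : a < b) (n : nat)
    (hn : (0 < n)%N) :
  maximal_generator a b (bsd n a b) =
  closure (U n a b `&` LP n a b : set {ptws itv_cc a b -> R}).
Proof.
case: n hn => // m _; rewrite closure_U_LP //; apply/seteqP; split=> u.
  exact: maximal_generator_clcone.
exact: clcone_maximal_generator.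
Qed.
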